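(* Let $d\ge2$, let $2\le n_1<n_2<\dots<n_d$ be integers, let $\mathcal{D}=\{\mathbf{i}_1,\dots,\mathbf{i}_N\}\subset\prod_{j=1}^d\{0,1,\dots,n_j-1\}$, and let $E=K(\{n_j\}_{j=1}^d,\mathcal{D})$ be the associated self-affine Sierpiński sponge. Assume $E$ is non-degenerated. Then $E$ satisfies the maximal power law if and only if $E$ and all the projections $\pi_j(E)$, $1\le j\le d-1$, possess trivial points.
   Context: Self-affine Sierpiński sponge: let $\Lambda=\operatorname{diag}(n_1,\dots,n_d)$ and $S_{\mathbf{i}}(z)=\Lambda^{-1}(z+\mathbf{i})$ for $\mathbf{i}\in\mathcal{D}$, $z\in\mathbb{R}^d$. $E=K(\{n_j\}_{j=1}^d,\mathcal{D})$ is the unique non-empty compact set with $E=\bigcup_{\mathbf{i}\in\mathcal{D}}S_{\mathbf{i}}(E)$; it carries the Euclidean metric. $E$ is degenerated if it is contained in a $(d-1)$-dimensional face of $[0,1]^d$, and non-degenerated otherwise. Projections: $\pi_j(x_1,\dots,x_d)=(x_1,\dots,x_j)$ for $1\le j\le d-1$. Trivial point: a point $z$ of a set $X$ is a trivial point of $X$ if $\{z\}$ is a connected component of $X$. $\delta$-connected components: for a metric space $(X,\rho)$ and $\delta>0$, two points $x,y\in X$ are $\delta$-equivalent if there is a finite sequence $x=x_1,x_2,\dots,x_k=y$ in $X$ with $\rho(x_i,x_{i+1})\le\delta$ for $1\le i\le k-1$. An equivalence class is called a $\delta$-connected component of $X$, and $h_X(\delta)$ denotes the number of $\delta$-connected components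 of $X$. Maximal power law: let $\gamma>0$. A compact metric space $X$ satisfies the power law with index $\gamma$ if $h_X(\delta)\asymp\delta^{-\gamma}$, i.e. there is a constant $c>1$ with $c^{-1}\delta^{-\gamma}\le h_X(\delta)\le c\,\delta^{-\gamma}$ for all $\delta\in(0,1)$. If in addition $\gamma=\dim_B X$ (the box-counting dimension), $X$ satisfies the maximal power law.
   Formalization: The formal theorem assumes N ≥ 2: for N = 1 the sponge is a single point, which has trivial points (as do its projections) when non-degenerated, but h_E is constantly 1, so no power law with γ > 0 holds and the claim fails. *)

(* Defs.v *)
From mathcomp Require Import all_boot all_order all_algebra.
From mathcomp Require Import finmap.
From mathcomp Require Import all_classical all_reals all_analysis.
Set Implicit Arguments.
Unset Strict Implicit.
Unset Printing Implicit Defensive.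
Import Order.TTheory GRing.Theory Num.Theory.
Import numFieldNormedType.Exports.
Local Open Scope classical_set_scope.
Local Open Scope ring_scope.

(* The library norm on row vectors is the sup norm, so the Euclidean distance
   is defined here.  Both induce the library topology of 'rV[R]_d, which is the
   one used below for compactness and connectedness. *)
Definition eucl_dist (R : realType) (d : nat) (x y : 'rV[R]_d) : R :=
  Num.sqrt (\sum_(k < d) (x 0 k - y 0 k) ^+ 2).

Definition sponge_map (R : realType) (d : nat) (n : 'I_d -> nat)
    (i : 'rV[nat]_d) (z : 'rV[R]_d) : 'rV[R]_d :=
  \row_k ((n k)%:R^-1 * (z 0 k + (i 0 k)%:R)).

(* By Hutchinson's theorem there is exactly one such set when D is nonempty
   and every n k is at least 2. *)
Definition is_sponge (R : realType) (d : nat) (n : 'I_d -> nat)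
    (D : {fset 'rV[nat]_d}) (E : set 'rV[R]_d) : Prop :=
  [/\ E !=set0, compact E &
      E = \bigcup_(i in [set` D]) (sponge_map n i @` E)].

Definition cube_facet (R : realType) (d : nat) (k : 'I_d) (b : bool) :
    set 'rV[R]_d :=
  [set z | (forall l, 0 <= z 0 l <= 1) /\ z 0 k = b%:R].

Definition degenerated (R : realType) (d : nat) (E : set 'rV[R]_d) : Prop :=
  exists (k : 'I_d) (b : bool), E `<=` cube_facet k b.

(* The first j coordinates; j : 'I_d ranges over 0, ..., d - 1. *)
Definition proj_first (R : realType) (d : nat) (j : 'I_d) (z : 'rV[R]_d) : 'rV[R]_j :=
  \row_(k < j) z 0 (widen_ord (ltnW (ltn_ord j)) k).

Definition trivial_point (T : topologicalType) (X : set T) (z : T) : Prop :=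
  X z /\ connected_component X z = [set z].

Section Metric.
Context (R : realType) (T : choiceType) (rho : T -> T -> R).
Implicit Types (X : set T) (delta gamma r : R).

Definition delta_equiv X delta (x y : T) : Prop :=
  exists s : seq T, [/\ path (fun a b => rho a b <= delta) x s,
    last x s = y & forall z, z \in x :: s -> X z].

Definition delta_components X delta : set (set T) :=
  [set delta_equiv X delta x | x in X].

(* For compact X the set of components is finite; [fset_set] sends an infinite
   set to the empty one. *)
Definition num_delta_components X delta : nat := #|` fset_set (delta_components X delta)|%fset.

Definition power_law X gamma : Prop :=
  exists2 c : R, 1 < c & forall delta, 0 < delta < 1 ->
    c^-1 * delta `^ (- gamma) <= (num_delta_components X delta)%:R
      <= c * delta `^ (- gamma).

Definition covered_by X r (m : nat) : Prop :=
  exists U : 'I_m -> set T,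
    (forall i x y, U i x -> U i y -> rho x y <= r) /\
    X `<=` \bigcup_i U i.

(* Least number of sets of diameter at most r covering X. *)
Definition covering_number X r : R :=
  inf [set m%:R | m in [set m | covered_by X r m]].

(* The box-counting dimension of X exists and equals gamma. *)
Definition is_box_dim X gamma : Prop :=
  ln (covering_number X r) / - ln r @[r --> 0^'+] --> gamma.

Definition maximal_power_law X : Prop :=
  exists2 gamma, 0 < gamma & power_law X gamma /\ is_box_dim X gamma.

End Metric.

(* Main.v *)
Require Import Defs.
From mathcomp Require Import all_boot all_order all_algebra.
From mathcomp Require Import finmap.
From mathcomp Require Import all_classical all_reals all_analysis.
From mathcomp Require Import lra ring zify.
Set Implicit Arguments.
Unset Strict Implicit.
Unset Printing Implicit Defensive.
Import Order.TTheory GRing.Theory Num.Theory.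
Import numFieldNormedType.Exports.
Local Open Scope classical_set_scope.
Local Open Scope ring_scope.

(* Call island, for the coordinates 0..k, a relatively clopen part of E that is
   separated from its complement, and from the faces of the cube, as measured by
   those coordinates only. Trivial points of the projection to these coordinates
   exist iff islands do: the copies of an island along a periodic word shrink to
   a trivial point; conversely, a trivial point with as few boundary coordinates
   as possible is interior, because E is non-degenerated, and its small clopen
   neighbourhoods are islands.
   At scale 1/M, E splits into P(M) approximate cells, obtained by keeping the
   first log_(n_k) M digits of the k-th coordinate; P(M) is comparable to M^g, g
   being the box dimension, and it bounds the number of delta-components for
   delta of order 1/M. If islands exist for all k, inserting words that lead into
   them at the end of each block of digits separates the cells, so that bound is
   attained. If there is no island for 0..k, every clopen part meets a face, so
   each delta-component meets a cell whose digits, in the block where exactly the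
   coordinates 0..k are kept, all come from a proper subset of the digits; the
   number of such cells is o(P(M)) along a sequence of M for which that block
   grows. *)

(** * Chains of small step in compact sets *)

(** Why initial segments of coordinates occur: the [n k] increase, so the larger a coordinate, the
    fewer digits resolve it to scale 1/M. Where only the digits of the coordinates 0..k are still
    kept, cells can be told apart by these coordinates alone, and any separation must come from
    them. A trivial point does not suffice for that: if it lies on a face of the cube, a
    neighbouring copy of E may be attached to each of its copies. The distance to the faces required
    of an island is what makes the separation pass to all copies. Connectedness enters only in the
    translation of trivial points. Elsewhere the argument uses chains of small step, which are what
    [power_law] counts and which scale coordinate by coordinate under the affine maps. From the
    power law to islands, only the inequality between g and the box dimension with g on the smaller
    side is needed: a larger exponent strengthens the lower bound in the power law. *)

Section DeltaChains.
Context (R : realType) (T : choiceType) (rho : T -> T -> R).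
Implicit Types (X : set T) (x y z : T) (dl : R).

Lemma delta_equiv_refl X dl x : X x -> delta_equiv rho X dl x x.
Proof. by move=> Xx; exists [::]; split=> // z; rewrite inE => /eqP->. Qed.

Lemma delta_equiv_step X dl x y z : delta_equiv rho X dl x y ->
  X z -> rho y z <= dl -> delta_equiv rho X dl x z.
Proof.
move=> [s [ps ls sX]] Xz yz; exists (rcons s z); split.
- by rewrite rcons_path ps ls.
- by rewrite last_rcons.
- move=> u; rewrite -rcons_cons mem_rcons inE => /orP[/eqP->//|]; exact: sX.
Qed.

(** Induction along a chain; the invariant may use that the current point is still linked to [x]. *)
Lemma delta_equiv_inv X dl (P : T -> Prop) x y :
  (forall a b, delta_equiv rho X dl x a -> X b -> rho a b <= dl -> P a -> P b) ->
  P x -> delta_equiv rho X dl x y -> P y.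
Proof.
move=> HP Px [s [ps ls sX]]; rewrite -{}ls.
elim/last_ind: s ps sX => [//|s b IH].
rewrite rcons_path last_rcons => /andP[ps sb] sX.
have sX' z : z \in x :: s -> X z.
  by move=> zs; apply: sX; rewrite -rcons_cons mem_rcons inE zs orbT.
apply: (HP (last x s)) sb _.
- by exists s; split.
- by apply: sX; rewrite -rcons_cons mem_rcons mem_head.
- exact: IH.
Qed.

Lemma delta_equiv_in X dl x y : X x -> delta_equiv rho X dl x y -> X y.
Proof. by move=> Xx; apply: delta_equiv_inv. Qed.

Lemma delta_equiv_src X dl x y : delta_equiv rho X dl x y -> X x.
Proof. by move=> [s [_ _ sX]]; apply: sX; rewrite mem_head. Qed.

Lemma delta_equiv_trans X dl x y z : delta_equiv rho X dl x y ->
  delta_equiv rho X dl y z -> delta_equiv rho X dl x z.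
Proof.
move=> xy; apply: delta_equiv_inv => // a b _ Xb ab xa.
exact: delta_equiv_step ab.
Qed.

Lemma delta_equiv_sym X dl x y : (forall a b, rho a b = rho b a) ->
  delta_equiv rho X dl x y -> delta_equiv rho X dl y x.
Proof.
move=> rhoC xy; have Xx := delta_equiv_src xy.
apply: (delta_equiv_inv (P := fun y => delta_equiv rho X dl y x)) xy; last exact: delta_equiv_refl.
move=> a b xa Xb ab ax; apply: delta_equiv_trans ax.
apply: (delta_equiv_step (y := b)); last by rewrite rhoC.
- exact: delta_equiv_refl.
- exact: delta_equiv_in xa.
Qed.

Lemma delta_equiv_exit X dl (P : T -> Prop) x y :
  delta_equiv rho X dl x y -> P x -> ~ P y ->
  exists a b, [/\ delta_equiv rho X dl x a, X b, rho a b <= dl, P a & ~ P b].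
Proof.
move=> xy Px nPy; apply: contrapT => H; apply: nPy.
apply: delta_equiv_inv xy => // a b xa Xb ab Pa; apply: contrapT => nPb.
by apply: H; exists a, b; split.
Qed.

Lemma delta_equiv_le X dl dl' x y : dl <= dl' -> delta_equiv rho X dl x y ->
  delta_equiv rho X dl' x y.
Proof.
move=> le xy; have Xx := delta_equiv_src xy.
apply: delta_equiv_inv xy; last exact: delta_equiv_refl.
move=> a b _ Xb ab xa; apply: delta_equiv_step xa Xb _; exact: le_trans le.
Qed.

End DeltaChains.

Section CompactChains.
Context (R : realType) (V : normedModType R).
Local Notation dist := (fun x y : V => `|x - y|).

Lemma compact_seq_cluster (F : set V) (u : nat -> V) : compact F ->
  (forall i, F (u i)) ->
  exists2 x, F x & forall e N, 0 < e -> exists2 i, (N <= i)%N & `|u i - x| < e.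
Proof.
move=> cF Fu.
have [|x [Fx cx]] := cF (u @ \oo) _; first by exists 0%N => // i _; exact: Fu.
exists x => // e N e0.
have [] := cx [set y | exists2 i, (N <= i)%N & y = u i] (ball x e).
- by exists N => // i /= Ni; exists i.
- exact: nbhsx_ballx.
- move=> y [[i Ni ->]]; rewrite -ball_normE /= => uix.
  by exists i => //; rewrite distrC.
Qed.

Lemma invr_nat_lt (e : R) : 0 < e -> exists N, forall i, (N <= i)%N -> i.+1%:R^-1 < e.
Proof. by move=> e0; have [N _ HN] := near_infty_natSinv_lt (PosNum e0); exists N. Qed.

(** The points reached from [z] by chains of every step form a closed set [Q]. A splitting of [Q]
    would leave a positive gap, and chains of step tending to 0 that cross it would accumulate at a
    point of [Q] inside the gap. *)
Lemma connected_component_chain (F : set V) z w : compact F -> F z -> F w ->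
  (forall dl, 0 < dl -> delta_equiv dist F dl z w) -> connected_component F z w.
Proof.
move=> cF Fz Fw zw.
pose Q : set V := fun x => F x /\ forall dl, 0 < dl -> delta_equiv dist F dl z x.
have invr_i (i : nat) : 0 < i.+1%:R^-1 :> R by rewrite invr_gt0 ltr0Sn.
have Qlim (u : nat -> V) (x : V) : F x ->
    (forall i, delta_equiv dist F i.+1%:R^-1 z (u i)) ->
    (forall e N, 0 < e -> exists2 i, (N <= i)%N & `|u i - x| < e) -> Q x.
  move=> Fx Qu ux; split=> // dl dl0.
  have [N HN] := invr_nat_lt dl0.
  have [i Ni uix] := ux _ N dl0.
  apply: (@delta_equiv_step _ _ dist _ _ _ (u i)) => //; last exact: ltW.
  exact: delta_equiv_le (ltW (HN _ Ni)) (Qu i).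
suff cQ : connected Q.
  apply: (@connected_component_max _ F Q z) => //; last by move=> x [].
  by split=> // dl _; exact: delta_equiv_refl.
apply/connectedP => A [A0 QA sA].
(* [b] indexes the part of the splitting that does not contain [z]. *)
pose b := ~~ `[< A true z >].
have [ab Qz] : A (~~ b) z /\ Q z.
  have Qz : Q z by split=> // dl _; exact: delta_equiv_refl.
  split=> //; rewrite /b negbK; case: asboolP => // nAz.
  by move: Qz; rewrite QA => -[].
have QA' x : Q x -> A b x \/ A (~~ b) x.
  by rewrite QA; case: (b) => -[] /=; [right|left|left|right].
have AQ c x : A c x -> Q x by rewrite QA; case: c; [right|left].
have sepl x : closure (A (~~ b)) x -> A b x -> False.
  move=> h1 h2; case: sA => /= s1 s2.
  case: (b) h1 h2 => h1 h2; first by rewrite -[False]/(set0 x) -s1; split.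
  by rewrite -[False]/(set0 x) -s2; split.
have sepr x : A (~~ b) x -> closure (A b) x -> False.
  move=> h1 h2; case: sA => /= s1 s2.
  case: (b) h1 h2 => h1 h2; first by rewrite -[False]/(set0 x) -s2; split.
  by rewrite -[False]/(set0 x) -s1; split.
have [y Ay] := A0 b.
have clos (S : set V) x (u : nat -> V) : (forall i, S (u i)) ->
    (forall e N, 0 < e -> exists2 i, (N <= i)%N & `|u i - x| < e) -> closure S x.
  move=> Su ux U /nbhs_ballP[e /= e0 eU].
  have [i _ uix] := ux e 0%N e0.
  by exists (u i); split=> //; apply: eU; rewrite -ball_normE /= distrC.
have [e e0 He] : exists2 e : R, 0 < e & forall x x', A (~~ b) x -> A b x' -> e <= `|x - x'|.
  apply: contrapT => H.
  have {}H i : exists p : V * V, [/\ A (~~ b) p.1, A b p.2 & `|p.1 - p.2| < i.+1%:R^-1].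
    apply: contrapT => H'; apply: H; exists i.+1%:R^-1; first by rewrite invr_gt0.
    move=> x x' Ax Ax'; rewrite leNgt; apply/negP => xx'; apply: H'.
    by exists (x, x').
  have {H}[p Hp] := choice H.
  have p1Q i : Q (p i).1 by have [/AQ] := Hp i.
  have [x Fx ux] := @compact_seq_cluster F (fun i => (p i).1) cF (fun i => proj1 (p1Q i)).
  have Qx : Q x by apply: (Qlim _ _ Fx _ ux) => i; exact: proj2 (p1Q i) _ (invr_i i).
  have c1 : closure (A (~~ b)) x by apply: clos ux => i; have [] := Hp i.
  have c2 : closure (A b) x.
    apply: (clos _ _ (fun i => (p i).2)); first by move=> i; have [] := Hp i.
    move=> e' N e'0; have e20 : 0 < e' / 2 by rewrite divr_gt0.
    have [N' HN'] := invr_nat_lt e20.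
    have [i + uix] := ux _ (maxn N N') e20.
    rewrite geq_max => /andP[Ni N'i]; exists i => //.
    have [_ _ pi] := Hp i.
    rewrite (splitr e') -(subrK (p i).1 (p i).2) -addrA.
    apply: le_lt_trans (ler_normD _ _) _; rewrite ltrD //.
    by rewrite distrC; apply: lt_trans pi _; apply: HN'.
  by case: (QA' _ Qx) => Ax; [apply: sepl Ax|apply: sepr c2].
(* Chains from [z] to [y] must leave this neighbourhood; their exit points can accumulate in neither
   part. *)
pose P x := exists2 a, A (~~ b) a & `|x - a| < e / 2.
have e20 : 0 < e / 2 by rewrite divr_gt0.
have Pz : P z by exists z => //; rewrite subrr normr0.
have nPy : ~ P y.
  move=> [a Aa]; rewrite distrC => ya; have := He _ _ Aa Ay.
  by rewrite leNgt => /negP; apply; apply: lt_trans ya _; rewrite gtr_pMr // invf_lt1 ?ltr1n.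
have Hq i : exists q : V * V, [/\ delta_equiv dist F i.+1%:R^-1 z q.2,
    F q.2, `|q.1 - q.2| <= i.+1%:R^-1, P q.1 & ~ P q.2].
  have [_ /(_ i.+1%:R^-1)] := AQ _ _ Ay; rewrite invr_gt0 ltr0Sn => /(_ isT) zy.
  have [q1 [q2 [zq1 Fq2 q12 Pq nPq]]] := delta_equiv_exit zy Pz nPy.
  by exists (q1, q2); split=> //=; apply: delta_equiv_step zq1 _ _.
have {Hq}[q Hq] := choice Hq.
have Fq i : F (q i).2 by have [] := Hq i.
have [x Fx ux] := @compact_seq_cluster F (fun i => (q i).2) cF Fq.
have Qx : Q x by apply: (Qlim _ _ Fx _ ux) => i; have [] := Hq i.
case: (QA' _ Qx) => Ax.
  have e40 : 0 < e / 2 / 2 by rewrite divr_gt0.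
  have [N HN] := invr_nat_lt e40.
  have [i Ni uix] := ux _ N e40.
  have [_ _ q12 [a Aa qa] _] := Hq i.
  have := He _ _ Aa Ax; rewrite leNgt => /negP; apply.
  have -> : a - x = (a - (q i).1) + ((q i).1 - (q i).2) + ((q i).2 - x).
    by rewrite !addrA !subrK.
  have := ler_normD (a - (q i).1 + ((q i).1 - (q i).2)) ((q i).2 - x).
  have := ler_normD (a - (q i).1) ((q i).1 - (q i).2).
  have := HN _ Ni; rewrite (distrC a (q i).1).
  move: q12 qa uix => /=; move: (i.+1%:R^-1) => t; lra.
have [i _ uix] := ux _ 0%N e20.
by have [_ _ _ _] := Hq i; apply; exists x.
Qed.

(** [B] is open in [A] as the trace of its own [eta]-neighbourhood, and closed in [A] because the
    [eta]-neighbourhood of the rest of [A] misses it. *)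
Lemma connected_gap (A B : set V) (eta : R) : connected A -> B !=set0 -> B `<=` A ->
  0 < eta -> (forall x y, B x -> A y -> `|x - y| <= eta -> B y) -> B = A.
Proof.
move=> cA B0 BA eta0 HB; apply: cA => //.
- exists (\bigcup_(x in B) ball x eta).
    by apply: bigcup_open => x _; exact: ball_open.
  apply/seteqP; split=> x.
    by move=> Bx; split; [exact: BA|exists x => //; exact: ballxx].
  move=> [Ax [y By]]; rewrite -ball_normE /= => xy.
  exact: HB By Ax (ltW xy).
- exists (~` (\bigcup_(x in A `\` B) ball x eta)).
    by apply: open_closedC; apply: bigcup_open => x _; exact: ball_open.
  apply/seteqP; split=> x.
    move=> Bx; split; [exact: BA|move=> [y [Ay nBy]]].
    rewrite -ball_normE /= distrC => xy; apply: nBy; exact: HB Bx Ay (ltW xy).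
  move=> [Ax nx]; apply: contrapT => nBx; apply: nx.
  by exists x => //; exact: ballxx.
Qed.

End CompactChains.

(** * Words, cells and the digits of a sponge *)

Notation word_in D a := (all (fun i => i \in D) a).

Section Words.
Context (R : realType) (d : nat) (n : 'I_d -> nat).
Implicit Types (a b : seq 'rV[nat]_d) (i : 'rV[nat]_d) (k : 'I_d) (z : 'rV[R]_d).

Definition word_map a z : 'rV[R]_d := foldr (sponge_map n) z a.

(** The integer written in base [n k] by the [k]-th entries of the letters, the first letter
    leading: the place of the cell of [a] in the grid along coordinate [k]. *)
Definition word_pos k a : nat := foldl (fun p i => (p * n k + i ord0 k)%N) 0%N a.

Lemma word_pos_rcons k a i :
  word_pos k (rcons a i) = (word_pos k a * n k + i ord0 k)%N.
Proof. by rewrite /word_pos foldl_rcons. Qed.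

Lemma word_map_cat a b z : word_map (a ++ b) z = word_map a (word_map b z).
Proof. by rewrite /word_map foldr_cat. Qed.

Lemma word_pos_map k a b :
  map (fun i => i ord0 k) a = map (fun i => i ord0 k) b ->
  word_pos k a = word_pos k b.
Proof.
have E c : word_pos k c = foldl (fun p m => (p * n k + m)%N) 0%N (map (fun i => i ord0 k) c).
  by elim/last_ind: c => // c i IH; rewrite word_pos_rcons map_rcons foldl_rcons IH.
by rewrite !E => ->.
Qed.

Hypothesis hn2 : forall k, (2 <= n k)%N.

Lemma nk_gt0 k : 0 < (n k)%:R :> R.
Proof. by rewrite ltr0n; apply: leq_trans (hn2 k). Qed.

Lemma word_mapE a z k :
  word_map a z ord0 k = (z ord0 k + (word_pos k a)%:R) / (n k)%:R ^+ size a.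
Proof.
elim/last_ind: a z => [|a i IH] z; first by rewrite /= addr0 divr1.
rewrite /word_map foldr_rcons IH mxE word_pos_rcons size_rcons exprSr natrD natrM.
have n0 : (n k)%:R != 0 :> R by rewrite gt_eqF // nk_gt0.
by field; rewrite n0 expf_neq0.
Qed.

Definition digits_lt a := forall i, i \in a -> forall k, (i ord0 k < n k)%N.

Lemma word_pos_lt k a : digits_lt a -> (word_pos k a < n k ^ size a)%N.
Proof.
elim/last_ind: a => [//|a i IH] H.
have ia : (i ord0 k < n k)%N by apply: H; rewrite mem_rcons mem_head.
have {IH}: (word_pos k a < n k ^ size a)%N.
  by apply: IH => j ja; apply: H; rewrite mem_rcons inE ja orbT.
rewrite word_pos_rcons size_rcons expnSr; nia.
Qed.

Lemma word_pos_inj k a b : digits_lt a -> digits_lt b -> size a = size b ->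
  word_pos k a = word_pos k b ->
  map (fun i => i ord0 k) a = map (fun i => i ord0 k) b.
Proof.
elim/last_ind: a b => [|a i IH] b; first by case: b.
case/lastP: b => [|b j]; first by rewrite size_rcons.
move=> Ha Hb; rewrite !size_rcons !word_pos_rcons !map_rcons => -[sab] E.
have ia : (i ord0 k < n k)%N by apply: Ha; rewrite mem_rcons mem_head.
have jb : (j ord0 k < n k)%N by apply: Hb; rewrite mem_rcons mem_head.
have n0 : (0 < n k)%N by apply: leq_trans (hn2 k).
have ij : i ord0 k = j ord0 k.
  by have := congr1 (modn^~ (n k)) E; rewrite !modnMDl !modn_small.
rewrite ij; congr rcons; apply: IH => //.
- by move=> l la; apply: Ha; rewrite mem_rcons inE la orbT.
- by move=> l la; apply: Hb; rewrite mem_rcons inE la orbT.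
- by move: E; rewrite ij => /addIn /eqP; rewrite eqn_pmul2r // => /eqP.
Qed.

End Words.

(** * Coding of the sponge, the unit cube and its faces *)

Section Sponge.
Context (R : realType) (d : nat) (n : 'I_d -> nat) (hn2 : forall k, (2 <= n k)%N).
Context (D : {fset 'rV[nat]_d}) (hD : forall i, i \in D -> forall k : 'I_d, (i ord0 k < n k)%N).
Context (E : set 'rV[R]_d) (hE : is_sponge n D E).
Implicit Types (a b : seq 'rV[nat]_d) (i : 'rV[nat]_d) (k : 'I_d) (x y z : 'rV[R]_d).

Lemma word_in_digits a : word_in D a -> digits_lt n a.
Proof. by move=> /allP aD i ia; apply: hD; exact: aD. Qed.

Lemma sponge_step i x : i \in D -> E x -> E (sponge_map n i x).
Proof.
move=> iD Ex; have [_ _ EE] := hE; rewrite EE.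
by exists i => //; exists x.
Qed.

Lemma sponge_word a x : word_in D a -> E x -> E (word_map n a x).
Proof.
move=> + Ex; elim: a => [//|i a IH] /= /andP[iD aD]; apply: sponge_step => //; exact: IH.
Qed.

Lemma sponge_inv x : E x -> exists i y, [/\ i \in D, E y & x = sponge_map n i y].
Proof.
have [_ _ EE] := hE; rewrite {1}EE => -[i /= iD [y Ey <-]].
by exists i, y.
Qed.

Lemma sponge_coding q x : E x ->
  exists a y, [/\ size a = q, word_in D a, E y & x = word_map n a y].
Proof.
elim: q x => [|q IH] x Ex; first by exists [::], x.
have [i [y [iD Ey ->]]] := sponge_inv Ex.
have [a [z [<- aD Ez ->]]] := IH _ Ey.
by exists (i :: a), z; split; rewrite /= ?iD ?aD.
Qed.

Lemma coord_max k : exists2 c, E c & forall x, E x -> x ord0 k <= c ord0 k.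
Proof.
have [E0 cE _] := hE.
have [|c] := @EVT_max_rV R d (fun x => x ord0 k) E E0 cE.
  by apply: continuous_subspaceT => x; exact: coord_continuous.
by rewrite inE => Ec H; exists c => // x Ex; apply: H; rewrite inE.
Qed.

Lemma coord_min k : exists2 c, E c & forall x, E x -> c ord0 k <= x ord0 k.
Proof.
have [E0 cE _] := hE.
have [|c] := @EVT_min_rV R d (fun x => x ord0 k) E E0 cE.
  by apply: continuous_subspaceT => x; exact: coord_continuous.
by rewrite inE => Ec H; exists c => // x Ex; apply: H; rewrite inE.
Qed.

Lemma sponge_coord i x k :
  (n k)%:R * sponge_map n i x ord0 k = x ord0 k + (i ord0 k)%:R.
Proof.
by rewrite mxE mulrA mulfV ?mul1r // gt_eqF // nk_gt0.
Qed.

(** At a maximum [u] of coordinate [k] on [E], the fixed-point equation gives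
    [n k * u <= u + n k - 1]; the minimum is similar. *)
Lemma sponge_cube x k : E x -> 0 <= x ord0 k <= 1.
Proof.
move=> Ex.
have n2 : 2 <= (n k)%:R :> R by rewrite ler_nat.
have [c /sponge_inv[i [y [iD Ey cE]]] Hc] := coord_min k.
have [c' /sponge_inv[i' [y' [iD' Ey' cE']]] Hc'] := coord_max k.
have := Hc _ Ex; have := Hc' _ Ex; have := Hc _ Ey; have := Hc' _ Ey'.
have := sponge_coord i y k; rewrite -cE; have := sponge_coord i' y' k; rewrite -cE'.
have i0 : 0 <= (i ord0 k)%:R :> R by [].
have : (i' ord0 k)%:R + 1 <= (n k)%:R :> R by rewrite natr1 ler_nat hD.
move: (c _ _) (c' _ _) (y _ _) (y' _ _) (x _ _) => u u' v v' w.
by move=> *; apply/andP; split; nra.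
Qed.

(* Digits at position [b * (n k - 1)] are the extremal ones facing the face [z_k = b]. *)
Lemma sponge_face_digit (b : bool) i x k : i \in D -> E x ->
  sponge_map n i x ord0 k = b%:R -> i ord0 k = (b * (n k).-1)%N /\ x ord0 k = b%:R.
Proof.
move=> iD Ex.
have := sponge_coord i x k.
have n2 : 2 <= (n k)%:R :> R by rewrite ler_nat.
have i1 : (i ord0 k)%:R + 1 <= (n k)%:R :> R by rewrite natr1 ler_nat hD.
have i0 : 0 <= (i ord0 k)%:R :> R by [].
have /andP[x0 x1] := sponge_cube k Ex.
move=> sE bE; move: sE; rewrite bE; case: b {bE} => /= sE.
  have -> : x ord0 k = 1 by lra.
  split=> //; apply/eqP; rewrite mul1n -(eqr_nat R) -subn1 natrB; last first.
    exact: leq_trans (hn2 k).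
  by apply/eqP; lra.
have -> : x ord0 k = 0 by lra.
split=> //; apply/eqP; rewrite mul0n -(eqr_nat R); apply/eqP; lra.
Qed.

Lemma word_face_digit (b : bool) a x k : word_in D a -> E x ->
  word_map n a x ord0 k = b%:R ->
  forall i, i \in a -> i ord0 k = (b * (n k).-1)%N.
Proof.
move=> aD Ex; elim: a aD => [//|j a IH] /= /andP[jD aD] /sponge_face_digit [//||jE aE].
  exact: sponge_word.
by move=> i; rewrite inE => /orP[/eqP->//|]; exact: IH.
Qed.

(** If all digits faced the same face, the fixed-point equation at the extremal points of coordinate
    [k] would put all of [E] on it. *)
Lemma nondegenerate_digit (b : bool) k : ~ degenerated E ->
  exists2 i, i \in D & i ord0 k != (b * (n k).-1)%N.
Proof.
move=> nd; apply: contrapT => H; apply: nd; exists k, b => x Ex.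
split; first by move=> l; exact: sponge_cube.
have {}H i : i \in D -> i ord0 k = (b * (n k).-1)%N.
  by move=> iD; apply/eqP; rewrite -[_ == _]negbK; apply/negP => ni; apply: H; exists i.
have n2 : 2 <= (n k)%:R :> R by rewrite ler_nat.
have [c /sponge_inv[i [y [iD Ey cE]]] Hc] := coord_min k.
have [c' /sponge_inv[i' [y' [iD' Ey' cE']]] Hc'] := coord_max k.
have := Hc _ Ex; have := Hc' _ Ex; have := Hc _ Ey; have := Hc' _ Ey'.
have := sponge_coord i y k; rewrite -cE; have := sponge_coord i' y' k; rewrite -cE'.
rewrite !H // natrM -subn1 natrB; last exact: leq_trans (hn2 k).
move: (c _ _) (c' _ _) (y _ _) (y' _ _) (x _ _) => u u' v v' w.
by case: b {H}; move=> *; nra.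
Qed.

End Sponge.

(** * Islands *)

Section CoordDist.
Context (R : realType) (d : nat).
Implicit Types (J : pred 'I_d) (k : 'I_d) (x y z : 'rV[R]_d).

(** Only a pseudometric: being blind to the other coordinates, it expresses on [E] itself the
    separation of parts of a projection. *)
Definition coord_dist J x y : R :=
  \big[Num.max/0]_(k | J k) `|x ord0 k - y ord0 k|.

Lemma coord_dist_leP J x y r : 0 <= r ->
  coord_dist J x y <= r <-> forall k, J k -> `|x ord0 k - y ord0 k| <= r.
Proof.
move=> r0; split=> [/bigmax_leP[_ H]//|H].
by apply/bigmax_leP; split.
Qed.

Lemma coord_dist_ge0 J x y : 0 <= coord_dist J x y.
Proof. by rewrite /coord_dist; apply: (@bigmax_ge_id _ R). Qed.

Lemma coord_distC J x y : coord_dist J x y = coord_dist J y x.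
Proof. by apply: eq_bigr => k _; rewrite distrC. Qed.

Lemma coord_le_dist J x y k : J k -> `|x ord0 k - y ord0 k| <= coord_dist J x y.
Proof. by move=> Jk; have /(coord_dist_leP J x y (coord_dist_ge0 J x y)) := lexx (coord_dist J x y); apply. Qed.

Lemma finite_pos_lb (I : finType) (P : pred I) (f : I -> R) :
  (forall i, P i -> 0 < f i) -> exists2 r, 0 < r & forall i, P i -> r <= f i.
Proof.
move=> H; exists (\big[Num.min/1]_(i | P i) f i).
  by apply: lt_bigmin; [exact: ltr01|exact: H].
by move=> i Pi; apply: bigmin_le_cond.
Qed.

Lemma expVn2_lt (e : R) : 0 < e -> exists q, (2 ^+ q)^-1 < e.
Proof.
move=> e0; have [N HN] := invr_nat_lt e0; exists N.
apply: le_lt_trans (HN N _) => //.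
rewrite lef_pV2 ?posrE ?exprn_gt0 // -natrX ler_nat; exact: ltn_expl.
Qed.

Lemma natr_dist_ge1 (u v : nat) : u <> v -> 1 <= `|u%:R - v%:R| :> R.
Proof.
move=> uv; have [lt|gt|//] := ltngtP u v.
  by rewrite distrC -natrB ?(ltnW lt) // ger0_norm // ler1n subn_gt0.
by rewrite -natrB ?(ltnW gt) // ger0_norm // ler1n subn_gt0.
Qed.

End CoordDist.

Section Islands.
Context (R : realType) (d : nat) (n : 'I_d -> nat) (hn2 : forall k, (2 <= n k)%N).
Context (D : {fset 'rV[nat]_d}) (hD : forall i, i \in D -> forall k : 'I_d, (i ord0 k < n k)%N).
Context (E : set 'rV[R]_d) (hE : is_sponge n D E) (J : pred 'I_d).
Implicit Types (a b : seq 'rV[nat]_d) (i : 'rV[nat]_d) (k : 'I_d) (x y z : 'rV[R]_d).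

Definition island (U : set 'rV[R]_d) (eta : R) := [/\ 0 < eta, U !=set0, U `<=` E,
  forall x y, U x -> E y -> coord_dist J x y <= eta -> U y &
  forall x k, U x -> J k -> eta <= x ord0 k <= 1 - eta].

(** Metric counterpart, read on [E], of a trivial point of the projection to [J]: the chain classes
    shrink to a point with the step. *)
Definition chain_small z := E z /\ forall r, 0 < r -> exists2 dl, 0 < dl &
  forall y, delta_equiv (coord_dist J) E dl z y -> coord_dist J z y <= r.

Definition nmax := (\max_k n k)%N.

Lemma le_nmax k : (n k <= nmax)%N.
Proof. exact: leq_bigmax. Qed.

Lemma powE k q : 0 < (n k)%:R ^+ q :> R.
Proof. by rewrite exprn_gt0 // nk_gt0. Qed.

Lemma pow2_le k q : 2 ^+ q <= (n k)%:R ^+ q :> R.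
Proof. by rewrite lerXn2r ?nnegrE // ler_nat. Qed.

Lemma pow_le_nmax k q : (n k)%:R ^+ q <= nmax%:R ^+ q :> R.
Proof. by rewrite lerXn2r ?nnegrE // ler_nat le_nmax. Qed.

Lemma pow2V_le k q : ((n k)%:R ^+ q)^-1 <= (2 ^+ q)^-1 :> R.
Proof. by rewrite lef_pV2 ?posrE ?powE ?exprn_gt0 // pow2_le. Qed.

Lemma word_map_diff a b x y k : size a = size b ->
  (n k)%:R ^+ size a * (word_map n a x ord0 k - word_map n b y ord0 k) =
  ((word_pos n k a)%:R + x ord0 k) - ((word_pos n k b)%:R + y ord0 k).
Proof.
move=> sab; rewrite !word_mapE // -sab -mulrBl mulrC divfK; last by rewrite gt_eqF ?powE.
by rewrite !(addrC _%:R).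
Qed.

Lemma word_map_dist a b x y k r : size a = size b ->
  `|((word_pos n k a)%:R + x ord0 k) - ((word_pos n k b)%:R + y ord0 k)| <= r ->
  `|word_map n a x ord0 k - word_map n b y ord0 k| <= r / (n k)%:R ^+ size a.
Proof.
move=> sab; rewrite -(word_map_diff _ _ _ sab) normrM (gtr0_norm (powE _ _)).
by rewrite ler_pdivlMr ?powE // mulrC.
Qed.

Lemma word_map_close a b x y k : size a = size b -> word_pos n k a = word_pos n k b ->
  E x -> E y ->
  `|word_map n a x ord0 k - word_map n b y ord0 k| <= ((n k)%:R ^+ size a)^-1.
Proof.
move=> sab ab Ex Ey; rewrite -[leRHS]mul1r; apply: word_map_dist => //.
have := sponge_cube hn2 hD hE k Ex; have := sponge_cube hn2 hD hE k Ey.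
by rewrite ab ler_norml => /andP[? ?] /andP[? ?]; apply/andP; split; lra.
Qed.

(** All words with the positions of [a] in [J] are taken together, since [coord_dist J] cannot
    separate their copies from one another. *)
Definition island_copy (U : set 'rV[R]_d) a : set 'rV[R]_d := fun x => exists b x',
  [/\ x = word_map n b x', word_in D b, size b = size a, U x' &
      forall k, J k -> word_pos n k b = word_pos n k a].

(** As [U] keeps away from the faces, a point this close has the same integer position in each
    coordinate of [J], the strict inequality excluding the adjacent one; then the gap of [U] itself
    applies after magnification. *)
Lemma island_copy_gap U eta a x y : island U eta -> island_copy U a x -> E y ->
  (forall k, J k -> `|x ord0 k - y ord0 k| < eta / (n k)%:R ^+ size a) ->
  island_copy U a y.
Proof.
move=> [eta0 _ UE Ugap Ubd] [b [x' [-> bD sba Ux' ba]]] Ey xy.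
have [c [y' [sca cD Ey' yE]]] := sponge_coding hE (size a) Ey.
have xy' k : J k -> `|((word_pos n k b)%:R + x' ord0 k) -
    ((word_pos n k c)%:R + y' ord0 k)| < eta.
  move=> Jk; rewrite -word_map_diff ?sba ?sca // -yE normrM (gtr0_norm (powE _ _)).
  by rewrite mulrC -ltr_pdivlMr ?powE // xy.
have cb k : J k -> word_pos n k c = word_pos n k b.
  move=> Jk; have := xy' k Jk; have := Ubd _ _ Ux' Jk.
  have := sponge_cube hn2 hD hE k Ey'.
  rewrite ltr_norml => /andP[y0 y1] /andP[x0 x1] /andP[l1 l2].
  apply/eqP; rewrite eqn_leq -ltnS -[X in _ && X]ltnS -!(ltr_nat R) -!natr1.
  by apply/andP; split; lra.
exists c, y'; split=> //; last by move=> k Jk; rewrite cb // ba.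
apply: Ugap Ux' Ey' _; apply/coord_dist_leP; first exact: ltW.
by move=> k Jk; have /ltW := xy' k Jk; rewrite cb // opprD addrACA subrr add0r.
Qed.

(** A small enough cell around a point of [U] lies in [U]. One letter more than required keeps the
    word non-empty, so that it can be repeated. *)
Lemma island_word U eta : island U eta ->
  exists a, [/\ word_in D a, (0 < size a)%N & forall x, E x -> U (word_map n a x)].
Proof.
move=> [eta0 [x Ux] UE Ugap Ubd].
have [q Hq] := expVn2_lt eta0.
have [a [x' [sa aD Ex' xE]]] := sponge_coding hE q.+1 (UE _ Ux).
exists a; split=> //.
  by rewrite sa.
move=> y Ey; apply: Ugap Ux _ _; first exact: (sponge_word hE).
apply/coord_dist_leP; first exact: ltW.
move=> k Jk; rewrite xE.
apply: le_trans (word_map_close (k := k) (erefl (size a)) _ Ex' Ey) _ => //.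
rewrite sa; apply: le_trans (pow2V_le _ _) _.
apply: le_trans (ltW Hq).
by rewrite lef_pV2 ?posrE ?exprn_gt0 // ler_eXn2l // ltr1n.
Qed.

(** Inside the cell of [a], chains from the image of [z] magnify to chains from [z], which stay
    small. A chain that goes far must pass to a cell with another position, and does so close to the
    image of [z]. *)
Lemma chain_small_push z a : E z -> word_in D a -> chain_small z ->
  ~ chain_small (word_map n a z) ->
  forall r, 0 < r -> exists b y, [/\ size b = size a, word_in D b, E y,
    forall k, J k -> `|((word_pos n k b)%:R + y ord0 k) -
                       ((word_pos n k a)%:R + z ord0 k)| <= r &
    exists2 k, J k & word_pos n k b <> word_pos n k a].
Proof.
move=> Ez aD [_ smz] nsm r r_gt0.
have [r0 r00 Hr0] : exists2 r0, 0 < r0 & forall dl, 0 < dl -> exists2 y,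
    delta_equiv (coord_dist J) E dl (word_map n a z) y &
    r0 < coord_dist J (word_map n a z) y.
  apply: contrapT => H; apply: nsm; split; first exact: (sponge_word hE).
  move=> r0 r00; apply: contrapT => H'; apply: H; exists r0 => // dl dl0.
  apply: contrapT => H; apply: H'; exists dl => // y zy; rewrite leNgt; apply/negP => lt.
  by apply: H; exists y.
pose K : R := nmax%:R ^+ size a.
(* One [r / 2] is for the drift of the chain inside the cell, the other for the step that leaves it;
   [r0] forbids a chain confined to the cell from going far. *)
pose r1 := Num.min (r / 2) r0.
have r10 : 0 < r1 by rewrite lt_min r00 divr_gt0.
have [d1 d10 Hd1] := smz _ r10.
have [k0 _|J0] := pickP J; last first.
  have [y _] := Hr0 1 ltr01.
  by rewrite /coord_dist big_pred0 // ltNge (ltW r00).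
have K0 : 0 < K.
  rewrite /K exprn_gt0 // ltr0n; apply: leq_trans (le_nmax k0).
  exact: leq_trans (hn2 k0).
pose dl := Num.min d1 (r / 2) / K.
have dl0 : 0 < dl by rewrite divr_gt0 // lt_min d10 divr_gt0.
have [y zy fary] := Hr0 _ dl0.
pose P x := exists b x', [/\ x = word_map n b x', word_in D b, size b = size a,
  forall k, J k -> word_pos n k b = word_pos n k a &
  delta_equiv (coord_dist J) E d1 z x'].
have Pz : P (word_map n a z) by exists a, z; split=> //; exact: delta_equiv_refl.
have nPy : ~ P y.
  move=> [b [x' [yE bD sb ba zx']]]; move: fary; rewrite ltNge => /negP; apply.
  apply/coord_dist_leP; first exact: ltW.
  move=> k Jk; rewrite yE; apply: le_trans (word_map_dist (r := r0) _ _) _ => //.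
    rewrite ba // opprD addrACA subrr add0r.
    apply: le_trans (coord_le_dist _ _ Jk) _.
    by apply: le_trans (Hd1 _ zx') _; rewrite ge_min lexx orbT.
  by rewrite ler_pdivrMr ?powE // ler_peMr ?(ltW r00) // exprn_ege1 // ler1n; exact: leq_trans (hn2 k).
have [x [w [zx Ew xw [b [x' [xE bD sb ba zx']]] nPw]]] := delta_equiv_exit zy Pz nPy.
have [c [w' [sc cD Ew' wE]]] := sponge_coding hE (size a) Ew.
have cb k : J k -> `|((word_pos n k c)%:R + w' ord0 k) -
    ((word_pos n k b)%:R + x' ord0 k)| <= Num.min d1 (r / 2).
  move=> Jk; rewrite -word_map_diff ?sb ?sc // -wE -xE normrM (gtr0_norm (powE _ _)).
  have := coord_le_dist w x Jk; rewrite coord_distC => wx.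
  apply: (@le_trans _ _ (K * dl)).
    apply: ler_pM; [by rewrite ltW ?powE|by []|exact: pow_le_nmax|exact: le_trans xw].
  by rewrite mulrC divfK // gt_eqF.
exists c, w'; split=> //.
  move=> k Jk; have := cb k Jk; rewrite le_min => /andP[_].
  have := coord_le_dist z x' Jk.
  have : coord_dist J z x' <= r / 2 by apply: le_trans (Hd1 _ zx') _; rewrite ge_min lexx.
  rewrite ba // !ler_norml => t1 /andP[t2 t3] /andP[t4 t5].
  by apply/andP; split; lra.
apply: contrapT => H; apply: nPw.
have {}H k : J k -> word_pos n k c = word_pos n k a.
  by move=> Jk; apply: contrapT => ca; apply: H; exists k.
exists c, w'; split=> //.
apply: delta_equiv_step zx' Ew' _; apply/coord_dist_leP; first exact: ltW.
move=> k Jk; have := cb k Jk; rewrite le_min => /andP[+ _].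
by rewrite distrC ba // H // opprD addrACA subrr add0r.
Qed.

End Islands.

(** * From trivial points to islands *)

Section TrivialToIsland.
Context (R : realType) (d : nat) (n : 'I_d -> nat) (hn2 : forall k, (2 <= n k)%N).
Context (D : {fset 'rV[nat]_d}) (hD : forall i, i \in D -> forall k : 'I_d, (i ord0 k < n k)%N).
Context (E : set 'rV[R]_d) (hE : is_sponge n D E) (J : pred 'I_d).
Implicit Types (a b : seq 'rV[nat]_d) (i : 'rV[nat]_d) (k : 'I_d) (x y z : 'rV[R]_d).

Definition bdry_coord z k := J k && ((z ord0 k == 0) || (z ord0 k == 1)).

(* Distance, in grid steps, of the cell of the word [a] to the corner of the
   cube selected by the boundary coordinates of [z]. *)
Definition corner_dist z a := (\sum_(k | bdry_coord z k)
  if z ord0 k == 0%R then word_pos n k a else (n k ^ size a).-1 - word_pos n k a)%N.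

Let posE a k : word_in D a -> (word_pos n k a)%:R + 1 <= (n k)%:R ^+ size a :> R.
Proof.
by move=> aD; rewrite natr1 -natrX ler_nat; apply: word_pos_lt; apply: word_in_digits aD.
Qed.

Lemma bdry_coord_word z a k : E z -> word_in D a ->
  bdry_coord (word_map n a z) k ->
  bdry_coord z k /\ word_pos n k a = (if z ord0 k == 0%R then 0 else (n k ^ size a).-1)%N.
Proof.
move=> Ez aD; rewrite /bdry_coord word_mapE //.
have /andP[z0 z1] := sponge_cube hn2 hD hE k Ez.
have n0 := powE R hn2 k (size a).
have p0 : 0 <= (word_pos n k a)%:R :> R by [].
have p1 := posE k aD.
case: (J k) => //=.
rewrite mulf_eq0 invr_eq0 (gt_eqF n0) orbF => /orP[/eqP e|/eqP e].
  have z00 : z ord0 k = 0 by lra.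
  rewrite z00 eqxx; split=> //; apply/eqP; rewrite -(eqr_nat R); apply/eqP; lra.
have {}e : z ord0 k + (word_pos n k a)%:R = (n k)%:R ^+ size a.
  by rewrite (canRL (divfK _) e) ?mul1r // gt_eqF.
have -> : z ord0 k = 1 by lra.
rewrite eqxx oner_eq0 orbT; split=> //; apply/eqP.
rewrite -(eqr_nat R) -subn1 natrB ?expn_gt0 ?(ltnW (hn2 k)) // natrX; apply/eqP; lra.
Qed.

(** No coordinate newly reaches the boundary, and one where the cell stays away from the corner
    becomes interior. *)
Lemma corner_dist_bdry z a : E z -> word_in D a -> (0 < corner_dist z a)%N ->
  (#|bdry_coord (word_map n a z)| < #|bdry_coord z|)%N.
Proof.
move=> Ez aD; rewrite lt0n sum_nat_eq0 negb_forall => /existsP[k].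
rewrite negb_imply => /andP[bk nk].
apply: proper_card; apply/properP; split.
  by apply/fintype.subsetP => l bl; have [] := bdry_coord_word Ez aD bl.
exists k => //; apply/negP => bk'; move: nk.
have [_ ->] := bdry_coord_word Ez aD bk'.
by case: (z ord0 k == 0); rewrite ?subnn.
Qed.

(** Where [z] is interior, a cell this close has the same position. Where [z] is on a face, the only
    other possible position is across that face, one step nearer to the corner. *)
Lemma corner_dist_lt z a b r : size b = size a -> word_in D a -> word_in D b ->
  E z -> r < 2^-1 -> 0 < r ->
  (forall k, J k && ~~ bdry_coord z k -> r < z ord0 k < 1 - r) ->
  forall y, E y ->
  (forall k, J k -> `|((word_pos n k b)%:R + y ord0 k) -
                      ((word_pos n k a)%:R + z ord0 k)| <= r) ->
  [/\ forall k, J k -> ~~ bdry_coord z k -> word_pos n k b = word_pos n k a,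
      forall k, J k -> `|(word_pos n k b)%:R - (word_pos n k a)%:R| <= 1 :> R &
      (exists2 k, J k & word_pos n k b <> word_pos n k a) ->
      (corner_dist z b < corner_dist z a)%N].
Proof.
move=> sba aD bD Ez r2 r0 Hr y Ey Hy.
have cmp k : J k -> [/\ ~~ bdry_coord z k -> word_pos n k b = word_pos n k a,
    z ord0 k = 0 -> word_pos n k b = word_pos n k a \/ (word_pos n k b).+1 = word_pos n k a &
    z ord0 k = 1 -> word_pos n k b = word_pos n k a \/ word_pos n k b = (word_pos n k a).+1].
  move=> Jk.
  have /andP[y0 y1] := sponge_cube hn2 hD hE k Ey.
  have := Hy _ Jk; rewrite ler_norml => /andP[h1 h2].
  split.
  - move=> nb; have /andP[h3 h4] : r < z ord0 k < 1 - r by apply: Hr; rewrite Jk nb.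
    apply/eqP; rewrite eqn_leq -ltnS -[X in _ && X]ltnS -!(ltr_nat R) -!natr1.
    by apply/andP; split; lra.
  - move=> z0; have u1 : (word_pos n k b < (word_pos n k a).+1)%N.
      by rewrite -(ltr_nat R) -natr1; lra.
    have u2 : (word_pos n k a < (word_pos n k b).+2)%N.
      by rewrite -(ltr_nat R) -!natr1; lra.
    lia.
  - move=> z0; have u1 : (word_pos n k b < (word_pos n k a).+2)%N.
      by rewrite -(ltr_nat R) -!natr1; lra.
    have u2 : (word_pos n k a < (word_pos n k b).+1)%N.
      by rewrite -(ltr_nat R) -!natr1; lra.
    lia.
have bz k : bdry_coord z k -> [/\ J k, z ord0 k != 0 -> z ord0 k = 1 &
    (word_pos n k b < n k ^ size a)%N].
  move=> /andP[Jk zk]; split=> //.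
    by case/orP: zk => /eqP ->; rewrite ?eqxx.
  rewrite -sba; apply: word_pos_lt; exact: word_in_digits bD.
split=> [k Jk nb|k Jk|[k Jk kba]].
- by have [->] := cmp _ Jk.
- have [c1 c2 c3] := cmp _ Jk.
  have [bk|/c1 ->] := boolP (bdry_coord z k); last by rewrite subrr normr0.
  have [_ z1 _] := bz _ bk.
  have [/c2 []|/z1/c3 []] := eqVneq (z ord0 k) 0.
  + by move->; rewrite subrr normr0.
  + by move<-; rewrite -natr1 opprD addrA subrr add0r normrN normr1.
  + by move->; rewrite subrr normr0.
  + by move->; rewrite -natr1 addrAC subrr add0r normr1.
rewrite /corner_dist.
have bk : bdry_coord z k.
  by apply: contrapT => /negP nb; apply: kba; have [->] := cmp _ Jk.
rewrite (bigD1 k) // [ltnRHS](bigD1 k) //= -addSn; apply: leq_add.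
  have [_ z1 pb] := bz _ bk; have [c1 c2 c3] := cmp _ Jk; rewrite sba.
  move: (word_pos n k a) (word_pos n k b) kba pb c2 c3 z1; clear => u v kba pb c2 c3 z1.
  have [/c2 []|/z1/c3 []] := eqVneq (z ord0 k) 0; lia.
apply: leq_sum => l /andP[bl _]; rewrite sba.
have [Jl z1 pb] := bz _ bl; have [c1 c2 c3] := cmp _ Jl.
move: (word_pos n l a) (word_pos n l b) pb c2 c3 z1; clear => u v pb c2 c3 z1.
have [/c2 []|/z1/c3 []] := eqVneq (z ord0 l) 0; lia.
Qed.

(* A word whose cell misses the corner moves [z] to a point with fewer boundary
   coordinates. If that point is not small, a cell one step closer to the corner
   must come arbitrarily close to it; iterating, chains of arbitrarily small step
   run inside the grid row of [z] from the opposite face down to [z]. *)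
Lemma chain_small_interior z : ~ degenerated E -> chain_small E J z ->
  exists2 z', chain_small E J z' & forall k, ~~ bdry_coord z' k.
Proof.
move=> nd; have [m] := ubnP #|bdry_coord z|; elim: m z => // m IH z mz smz.
have [/existsP[k0 bk0]|] := boolP [exists k, bdry_coord z k]; last first.
  by rewrite negb_exists => /forallP H; exists z.
apply: contrapT => nI.
have Ez : E z by case: smz.
have nsm a : word_in D a -> (0 < corner_dist z a)%N -> ~ chain_small E J (word_map n a z).
  move=> aD ca sa; apply: nI; apply: IH sa.
  by apply: leq_trans (corner_dist_bdry Ez aD ca) _.
have [r [r0 r2 Hr]] : exists r : R, [/\ 0 < r, r < 2^-1 &
    forall k, J k && ~~ bdry_coord z k -> r < z ord0 k < 1 - r].
  have [|r r0 Hr] := @finite_pos_lb R _ (fun k => J k && ~~ bdry_coord z k)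
      (fun k => Num.min (z ord0 k) (1 - z ord0 k)).
    move=> k /andP[Jk]; rewrite /bdry_coord Jk /= negb_or => /andP[z0 z1].
    have /andP[z0' z1'] := sponge_cube hn2 hD hE k Ez.
    by rewrite lt_min subr_gt0 !lt_neqAle z1 z0' z1' eq_sym z0.
  exists (Num.min r 2^-1 / 2); split.
  - by rewrite divr_gt0 // lt_min r0 invr_gt0 ltr0n.
  - have : Num.min r 2^-1 <= 2^-1 by rewrite ge_min lexx orbT.
    by move: (Num.min _ _) => t ht; lra.
  - move=> k /Hr; rewrite le_min => /andP[h1 h2].
    have : Num.min r 2^-1 <= r by rewrite ge_min lexx.
    by move: (Num.min _ _) => t ht; apply/andP; split; lra.
(* A push changes each position by at most one, hence moves the image of [z] by at most
   [(2 ^+ q)^-1]. *)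
have descent q a : size a = q -> word_in D a -> exists b, [/\ size b = q, word_in D b,
    corner_dist z b = 0%N,
    forall k, J k -> ~~ bdry_coord z k -> word_pos n k b = word_pos n k a &
    delta_equiv (coord_dist J) E (2 ^+ q)^-1 (word_map n a z) (word_map n b z)].
  have [c] := ubnP (corner_dist z a); elim: c a => // c IHc a cac sa aD.
  have [c0|] := posnP (corner_dist z a).
    exists a; split=> //; apply: delta_equiv_refl; exact: (sponge_word hE).
  move=> ca; have [b [y [sb bD Ey Hy neq]]] :=
    chain_small_push hn2 hE Ez aD smz (nsm _ aD ca) r0.
  have [p1 p2 /(_ neq) lt] := corner_dist_lt sb aD bD Ez r2 r0 Hr Ey Hy.
  have [||b' [sb' bD' cb' pb' eb']] := IHc b _ _ bD.
  - exact: leq_trans lt _.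
  - by rewrite sb.
  exists b'; split=> // [k Jk nb|]; first by rewrite pb' // p1.
  apply: delta_equiv_trans eb'.
  apply: (@delta_equiv_step _ _ _ _ _ _ (word_map n a z)).
  - by apply: delta_equiv_refl; exact: (sponge_word hE).
  - exact: (sponge_word hE).
  - apply/coord_dist_leP; first by rewrite invr_ge0 exprn_ge0.
    move=> k Jk; apply: le_trans (pow2V_le _ hn2 k q).
    rewrite -[leRHS]mul1r -sa; apply: word_map_dist => //.
    by rewrite opprD addrACA subrr addr0 distrC p2.
have [i iD ik] := nondegenerate_digit hn2 hD hE (z ord0 k0 == 1) k0 nd.
have iD' : word_in D [:: i] by rewrite /= iD.
have ci : (0 < corner_dist z [:: i])%N.
  rewrite lt0n sum_nat_eq0 negb_forall; apply/existsP; exists k0.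
  rewrite bk0 /= /word_pos /= mul0n add0n expn1.
  have ilt := hD iD k0.
  move: ik; have [->|z0] := eqVneq (z ord0 k0) 0.
    by rewrite [0 == 1]eq_sym oner_eq0 mul0n.
  have -> : z ord0 k0 == 1 by move: bk0; rewrite /bdry_coord (negbTE z0) => /andP[].
  rewrite mul1n => ine; rewrite subn_eq0 -ltnNge ltn_neqAle ine /= -ltnS prednK //.
  exact: ltnW (hn2 k0).
(* The contradiction: [y] below will lie in the [dl]-chain class of [z], so within 1/4 of [z], while
   its cell is a whole step away up to an error of 1/4, which makes it at least 3/4 away. *)
have [|dl dl0 Hdl] := smz.2 4^-1; first by rewrite invr_gt0 ltr0n.
pose s := Num.min r (Num.min (dl / 4) 4^-1).
have s0 : 0 < s by rewrite !lt_min r0 divr_gt0 // invr_gt0 ltr0n.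
have [sr sdl s4] : [/\ s <= r, s <= dl / 4 & s <= 4^-1].
  by rewrite /s; split; rewrite !ge_min lexx ?orbT.
have [b [y [sb bD Ey Hy neq]]] := chain_small_push hn2 hE Ez iD' smz (nsm _ iD' ci) s0.
have [p1 _ _] := corner_dist_lt sb iD' bD Ez r2 r0 Hr Ey (fun k Jk => le_trans (Hy k Jk) sr).
have [q Hq] : exists q, (2 ^+ q)^-1 < dl / 4 :> R by apply: expVn2_lt; rewrite divr_gt0.
have [v [y' [sv vD Ey' yE]]] := sponge_coding hE q Ey.
have [v0 [sv0 vD0 cv0 pv0 ev0]] := descent q v sv vD.
(* The chain goes from [z] to its image in the corner cell [v0], back along the descent to its image
   in the cell [v], and from there to [y]. In interior coordinates [v0] and [v] have equal
   positions, and [y] is close to [z]. *)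
have zy : delta_equiv (coord_dist J) E dl z y.
  apply: (@delta_equiv_step _ _ _ _ _ _ (word_map n v z)) => //.
    apply: (@delta_equiv_trans _ _ _ _ _ _ (word_map n v0 z)).
      apply: (@delta_equiv_step _ _ _ _ _ _ z); [exact: delta_equiv_refl|exact: (sponge_word hE)|].
      apply/coord_dist_leP; first exact: ltW.
      move=> k Jk; have [bk|nbk] := boolP (bdry_coord z k).
        apply: (@le_trans _ _ (dl / 4)); last by lra.
        apply: le_trans (ltW Hq); apply: le_trans (pow2V_le _ hn2 k q).
        move/eqP: cv0; rewrite sum_nat_eq0 => /forallP/(_ k); rewrite bk /=.
        have n0 := powE R hn2 k q.
        have vlt : (word_pos n k v0 < n k ^ q)%N.
          by rewrite -sv0; apply: word_pos_lt; exact: word_in_digits vD0.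
        rewrite word_mapE // sv0.
        have [z0 /eqP ->|z0] := eqVneq (z ord0 k) 0.
          by rewrite z0 addr0 mul0r subrr normr0 invr_ge0 ltW.
        have -> : z ord0 k = 1.
          by apply/eqP; move: bk; rewrite /bdry_coord (negbTE z0) => /andP[].
        move=> /eqP e; have {e}-> : (word_pos n k v0 = (n k ^ q).-1)%N.
          by move: e vlt; clear; lia.
        rewrite -subn1 natrB ?expn_gt0 ?(ltnW (hn2 k)) // natrX addrCA subrr addr0.
        by rewrite divff ?gt_eqF // subrr normr0 invr_ge0 ltW.
      have -> : word_map n v0 z ord0 k = word_map n v z ord0 k.
        by rewrite !word_mapE // pv0 // sv sv0.
      have := word_map_close hn2 hD hE (erefl (size v)) (erefl (word_pos n k v)) Ey' Ez.
      rewrite -yE sv => h1.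
      have := le_trans h1 (le_trans (pow2V_le _ hn2 k q) (ltW Hq)).
      have := Hy k Jk; rewrite p1 // opprD addrACA subrr add0r => h2.
      have := le_trans h2 sdl.
      rewrite !ler_norml => /andP[? ?] /andP[? ?]; apply/andP; split; lra.
    apply: delta_equiv_sym; first exact: coord_distC.
    apply: delta_equiv_le ev0; apply: le_trans (ltW Hq) _; lra.
  apply/coord_dist_leP; first exact: ltW.
  move=> k Jk; rewrite yE.
  apply: le_trans (word_map_close hn2 hD hE (erefl _) (erefl _) Ez Ey') _.
  rewrite sv; apply: le_trans (pow2V_le _ hn2 k q) _; apply: le_trans (ltW Hq) _; lra.
have far := Hdl _ zy.
have [k Jk kneq] := neq.
have : 1 <= `|(word_pos n k b)%:R - (word_pos n k [:: i])%:R| :> R.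
  exact: natr_dist_ge1.
have := le_trans (Hy k Jk) s4.
have := le_trans (coord_le_dist z y Jk) far.
rewrite ler_normr !ler_norml => /andP[h1 h2] /andP[h3 h4] /orP[]; lra.
Qed.

(** The island is the chain class of an interior small point, with a step for which it keeps half of
    the distance of that point to the faces. *)
Lemma chain_small_island z : ~ degenerated E -> chain_small E J z ->
  exists U eta, island E J U eta.
Proof.
move=> nd /(chain_small_interior nd)[{}z [Ez smz] nb].
have [|r r0 Hr] := @finite_pos_lb R _ J (fun k => Num.min (z ord0 k) (1 - z ord0 k)).
  move=> k Jk; have := nb k; rewrite /bdry_coord Jk /= negb_or => /andP[z0 z1].
  have /andP[z0' z1'] := sponge_cube hn2 hD hE k Ez.
  by rewrite lt_min subr_gt0 !lt_neqAle z1 z0' z1' eq_sym z0.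
have r20 : 0 < r / 2 by rewrite divr_gt0.
have [dl dl0 Hdl] := smz _ r20.
exists [set y | delta_equiv (coord_dist J) E dl z y], (Num.min dl (r / 2)); split.
- by rewrite lt_min dl0.
- by exists z; exact: delta_equiv_refl.
- by move=> y; exact: delta_equiv_in.
- move=> x y zx Ey xy; apply: delta_equiv_step zx Ey _; apply: le_trans xy _.
  by rewrite ge_min lexx.
- move=> x k zx Jk; have := le_trans (coord_le_dist z x Jk) (Hdl _ zx).
  have := Hr _ Jk; rewrite le_min => /andP[h1 h2].
  have : Num.min dl (r / 2) <= r / 2 by rewrite ge_min lexx orbT.
  rewrite ler_norml => t /andP[h3 h4]; apply/andP; split; lra.
Qed.

End TrivialToIsland.

(** * Projections *)

Lemma row_norm_leP (R : realType) m (x : 'rV[R]_m) r : 0 <= r ->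
  `|x| <= r <-> forall l, `|x ord0 l| <= r.
Proof.
move=> r0; rewrite (_ : `|x| = mx_norm x) // mx_normrE; split.
  move=> /bigmax_leP[_ H] l; exact: H (ord0, l) isT.
by move=> H; apply/bigmax_leP; split=> // -[u l] _; rewrite (ord1 u) /=.
Qed.

Section Projections.
Context (R : realType) (d : nat) (n : 'I_d -> nat) (hn2 : forall k, (2 <= n k)%N).
Context (D : {fset 'rV[nat]_d}) (hD : forall i, i \in D -> forall k : 'I_d, (i ord0 k < n k)%N).
Context (E : set 'rV[R]_d) (hE : is_sponge n D E) (j : nat) (w : 'I_j -> 'I_d).
Implicit Types (a b : seq 'rV[nat]_d) (k : 'I_d) (x y z : 'rV[R]_d).

(** Selecting coordinates by a map [w] treats [proj_first] and, with [w = id], the sponge itself at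
    once. *)
Definition coord_proj z : 'rV[R]_j := \row_l z ord0 (w l).

Definition proj_coord : pred 'I_d := fun k => [exists l, w l == k].

Let J := proj_coord.

Lemma coord_proj_dist x y : `|coord_proj x - coord_proj y| = coord_dist J x y.
Proof.
apply: le_anti; apply/andP; split.
  apply/row_norm_leP; first exact: coord_dist_ge0.
  move=> l; rewrite !mxE; apply: coord_le_dist.
  by apply/existsP; exists l.
apply/coord_dist_leP => // k /existsP[l /eqP <-].
have /row_norm_leP /(_ l) := lexx `|coord_proj x - coord_proj y|.
by rewrite !mxE; apply.
Qed.

Lemma delta_equiv_coord_proj dl x y : delta_equiv (coord_dist J) E dl x y ->
  delta_equiv (fun p q : 'rV[R]_j => `|p - q|) (coord_proj @` E) dl (coord_proj x) (coord_proj y).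
Proof.
move=> xy; have Ex := delta_equiv_src xy.
apply: (delta_equiv_inv (P := fun y => delta_equiv _ _ _ (coord_proj x) (coord_proj y))) xy.
  move=> a b _ Eb ab xa; apply: delta_equiv_step xa _ _; first by exists b.
  by rewrite /= coord_proj_dist.
by apply: delta_equiv_refl; exists x.
Qed.

Lemma coord_proj_compact : compact (coord_proj @` E).
Proof.
have [_ cE _] := hE; apply: continuous_compact cE; apply: continuous_subspaceT.
move=> x A /nbhs_ballP[e /= e0 eA]; apply/nbhs_ballP; exists e => //= y.
rewrite -ball_normE /= => xy; apply: eA; rewrite -ball_normE /=.
apply: le_lt_trans xy; rewrite coord_proj_dist; apply/coord_dist_leP => // k _.
have /row_norm_leP /(_ k) := lexx `|x - y|.
by rewrite !mxE; apply.
Qed.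

(** Otherwise, points farther than [r] from [z] are reached by chains of step tending to 0; their
    projections accumulate at a second point of the component of [p]. *)
Lemma trivial_point_small p : trivial_point (coord_proj @` E) p ->
  exists z, chain_small E J z.
Proof.
move=> [[z Ez zp] cp]; exists z; split=> // r r0; apply: contrapT => H.
have {}H (i : nat) : exists y, delta_equiv (coord_dist J) E i.+1%:R^-1 z y /\ r < coord_dist J z y.
  apply: contrapT => H'; apply: H; exists i.+1%:R^-1; first by rewrite invr_gt0.
  by move=> y zy; rewrite leNgt; apply/negP => lt; apply: H'; exists y.
have {H}[u Hu] := choice H.
have Fu (i : nat) : (coord_proj @` E) (coord_proj (u i)).
  by exists (u i) => //; have [zu _] := Hu i; exact: delta_equiv_in zu.
have [q Fq uq] := compact_seq_cluster coord_proj_compact Fu.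
have : connected_component (coord_proj @` E) p q.
  apply: connected_component_chain => //; first exact: coord_proj_compact.
    by exists z.
  move=> dl dl0; have [N HN] := invr_nat_lt dl0.
  have [i Ni uiq] := uq _ N dl0.
  apply: (@delta_equiv_step _ _ _ _ _ _ (coord_proj (u i))) => //; last exact: ltW.
  rewrite -zp; apply: delta_equiv_coord_proj.
  by have [zu _] := Hu i; apply: delta_equiv_le zu; rewrite ltW // HN.
rewrite cp /= => qp.
have [i _] := uq _ 0%N r0; have [_] := Hu i.
by rewrite qp -zp distrC coord_proj_dist => lt1 lt2; have := lt_trans lt1 lt2; rewrite ltxx.
Qed.

Lemma island_copy_flatten U eta a t x : island E J U eta -> word_in D a ->
  (forall x, E x -> U (word_map n a x)) -> E x ->
  forall s, (t < s)%N -> island_copy n D J U (flatten (nseq t a)) (word_map n (flatten (nseq s a)) x).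
Proof.
move=> isl aD aU Ex s ts.
have fD m : word_in D (flatten (nseq m a)).
  by elim: m => //= m IH; rewrite all_cat aD.
exists (flatten (nseq t a)), (word_map n (flatten (nseq (s - t) a)) x); split=> //.
  by rewrite -word_map_cat -flatten_cat -nseqD subnKC // ltnW.
have -> : (s - t = (s - t).-1.+1)%N by rewrite prednK // subn_gt0.
by rewrite /= word_map_cat; apply: aU; exact: (sponge_word hE).
Qed.

(** By [connected_gap], a connected set through the limit point cannot leave any of the nested
    copies, whose extent in [J] tends to 0. *)
Lemma island_trivial_point U eta : island E J U eta ->
  exists p, trivial_point (coord_proj @` E) p.
Proof.
move=> isl; have [a [aD sa aU]] := island_word hn2 hD hE isl.
have [eta0 _ _ _ _] := isl.
have [[x0 Ex0] cE _] := hE.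
pose u t := word_map n (flatten (nseq t a)) x0.
have Eu t : E (u t).
  apply: (sponge_word hE) => //; elim: t => //= t IH; by rewrite all_cat aD.
have [x Ex ux] := compact_seq_cluster cE Eu.
(* The gap makes a copy contain the limits of its points. *)
have copyx t : island_copy n D J U (flatten (nseq t a)) x.
  set f := flatten _.
  have [r r0 Hr] := @finite_pos_lb R _ predT (fun k => eta / (n k)%:R ^+ size f)
    (fun k _ => divr_gt0 eta0 (powE R hn2 k _)).
  have [s ts uxr] := ux _ t.+1 r0.
  apply: (island_copy_gap hn2 hD hE isl (x := u s)) => //.
    exact: island_copy_flatten isl aD aU Ex0 _ ts.
  move=> k Jk; apply: lt_le_trans (Hr k isT); apply: le_lt_trans uxr.
  rewrite distrC; have /row_norm_leP /(_ k) := lexx `|u s - x|.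
  by rewrite !mxE distrC; apply.
exists (coord_proj x); split; first by exists x.
have Fx : (coord_proj @` E) (coord_proj x) by exists x.
apply/seteqP; split=> [q|_ -> //]; last exact: connected_component_refl.
move=> [B [Bx BF cB] Bq] /=.
have HB t : `|q - coord_proj x| <= (2 ^+ t)^-1.
  set f := flatten (nseq t a).
  have szf : (t <= size f)%N.
    rewrite /f; elim: (t) => //= t' IH; rewrite size_cat; apply: leq_trans (leq_add sa IH).
    by rewrite add1n.
  have [r r0 Hr] := @finite_pos_lb R _ predT (fun k => eta / (n k)%:R ^+ size f)
    (fun k _ => divr_gt0 eta0 (powE R hn2 k _)).
  have : B `&` (coord_proj @` island_copy n D J U f) = B.
    apply: (connected_gap (eta := r / 2) cB) => //.
    - by exists (coord_proj x); split=> //; exists x => //; exact: copyx.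
    - by rewrite divr_gt0.
    - move=> p p' [_ [y yc <-]] Bp' pp'; split=> //.
      have [y' Ey' y'E] := BF _ Bp'; exists y' => //.
      apply: (island_copy_gap hn2 hD hE isl yc Ey') => k Jk.
      apply: lt_le_trans (Hr k isT).
      move: pp'; rewrite -y'E coord_proj_dist => /(le_trans (coord_le_dist y y' Jk)) => h.
      by apply: le_lt_trans h _; rewrite gtr_pMr // invf_lt1 ?ltr1n.
  move=> BE; move: Bq; rewrite -BE => -[_ [y yc <-]].
  have [b [y' [-> bD sb Uy' bf]]] := yc.
  have [b' [x' [xE bD' sb' Ux' bf']]] := copyx t.
  rewrite coord_proj_dist {1}xE; apply/coord_dist_leP; first by rewrite invr_ge0 exprn_ge0.
  have [_ _ UE _ _] := isl.
  move=> k Jk; apply: le_trans (word_map_close hn2 hD hE _ _ (UE _ Uy') (UE _ Ux')) _.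
  - by rewrite sb sb'.
  - by rewrite bf ?bf'.
  rewrite sb; apply: le_trans (pow2V_le _ hn2 _ _) _.
  by rewrite lef_pV2 ?posrE ?exprn_gt0 // ler_eXn2l // ltr1n.
apply/eqP; rewrite -subr_eq0 -normr_eq0 eq_le normr_ge0 andbT leNgt; apply/negP => q0.
have [t] := expVn2_lt q0; by rewrite ltNge HB.
Qed.

End Projections.

Lemma island_eq (R : realType) d (E : set 'rV[R]_d) (J J' : pred 'I_d) U eta :
  J =1 J' -> island E J U eta -> island E J' U eta.
Proof.
move=> JJ [e0 U0 UE Ug Ub]; split=> //.
- move=> x y Ux Ey; rewrite /coord_dist -(eq_bigl _ _ JJ); exact: Ug.
- by move=> x k Ux; rewrite -JJ; exact: Ub.
Qed.

(* Coordinates [0, ..., k]; the case [k = d - 1] is [E] itself. *)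
Definition upto d (k : 'I_d) : pred 'I_d := fun l => (l <= k)%N.

Section TrivialPointsIslands.
Context (R : realType) (d : nat) (n : 'I_d -> nat) (hn2 : forall k, (2 <= n k)%N).
Context (D : {fset 'rV[nat]_d}) (hD : forall i, i \in D -> forall k : 'I_d, (i ord0 k < n k)%N).
Context (E : set 'rV[R]_d) (hE : is_sponge n D E) (nd : ~ degenerated E).

Lemma trivial_point_island j (w : 'I_j -> 'I_d) (k : 'I_d) :
  proj_coord w =1 upto k ->
  (exists z, trivial_point (coord_proj w @` E) z) <->
  (exists U eta, island E (upto k) U eta).
Proof.
move=> wk; split.
  move=> [p /(trivial_point_small hE)[z /(chain_small_island hn2 hD hE nd)[U [eta isl]]]].
  by exists U, eta; exact: island_eq isl.
move=> [U [eta isl]]; apply: (island_trivial_point hn2 hD hE (U := U) (eta := eta)).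
by apply: island_eq isl => l; rewrite wk.
Qed.

Lemma trivial_points_islands : (2 <= d)%N ->
  ((exists z, trivial_point E z) /\
   (forall j : 'I_d, (1 <= j)%N -> exists z, trivial_point (proj_first j @` E) z)) <->
  (forall k : 'I_d, exists U eta, island E (upto k) U eta).
Proof.
move=> d2.
have d0 : (0 < d)%N by exact: ltnW.
have lastP : (d.-1 < d)%N by rewrite prednK.
have topE (k : 'I_d) : k = d.-1 :> nat -> ((exists z, trivial_point E z) <->
    (exists U eta, island E (upto k) U eta)).
  move=> kE; rewrite -(trivial_point_island (w := id)); last first.
    move=> l; rewrite /upto kE -ltnS prednK // ltn_ord.
    by apply/existsP; exists l.
  suff -> : coord_proj id @` E = E by [].
  rewrite -[RHS]image_id; apply: eq_imagel => z _.
  by apply/rowP => l; rewrite mxE.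
have projE (j k : 'I_d) : k.+1 = j -> ((exists z, trivial_point (proj_first j @` E) z) <->
    (exists U eta, island E (upto k) U eta)).
  move=> kj; apply: trivial_point_island => l; rewrite /upto -ltnS kj.
  apply/existsP/idP => [[i /eqP <-]|lj]; first exact: (ltn_ord i).
  by exists (Ordinal lj); apply/eqP/val_inj.
split=> [[tE tj] k|H].
  have [kd|kd] := ltnP k.+1 d.
    by apply/(projE (Ordinal kd)) => //; apply: tj.
  by apply/topE => //; apply/eqP; rewrite -eqSS prednK // eqn_leq ltn_ord.
split; first exact/(topE (Ordinal lastP)).
move=> j j0; have kd : (j.-1 < d)%N by apply: leq_ltn_trans (leq_pred _) (ltn_ord j).
by apply/(projE j (Ordinal kd)) => //=; rewrite prednK.
Qed.

End TrivialPointsIslands.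

(** * Counting components, covers and approximate cells *)

Section CountComponents.
Context (R : realType) (T : choiceType) (rho : T -> T -> R).
Hypothesis rhoC : forall x y, rho x y = rho y x.
Implicit Types (X B : set T) (dl : R).

Lemma delta_class_eq X dl x y : delta_equiv rho X dl x y ->
  delta_equiv rho X dl x = delta_equiv rho X dl y.
Proof.
move=> xy; apply/funext => z; apply/propext; split; apply: delta_equiv_trans => //.
exact: delta_equiv_sym.
Qed.

Lemma covered_by_fin (I : finType) X dl (U : I -> set T) :
  (forall i x y, U i x -> U i y -> rho x y <= dl) -> X `<=` \bigcup_i U i ->
  Defs.covered_by rho X dl #|I|.
Proof.
move=> dU XU; exists (fun i => U (enum_val i)); split; first by move=> i; exact: dU.
by move=> x /XU[i _ Ux]; exists (enum_rank i) => //; rewrite enum_rankK.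
Qed.

(** Components meeting [B] inside the same covering set coincide, since the diameter of that set is
    at most the step. *)
Lemma delta_components_cover X B dl m : B `<=` X ->
  (forall x, X x -> exists2 y, delta_equiv rho X dl x y & B y) ->
  Defs.covered_by rho B dl m ->
  finite_set (delta_components rho X dl) /\ (num_delta_components rho X dl <= m)%N.
Proof.
move=> BX XB [U [dU BU]].
pose g (i : 'I_m) : set T := if pselect (exists y, U i y /\ B y) is left e
  then delta_equiv rho X dl (projT1 (cid e)) else set0.
have sub : delta_components rho X dl `<=` [set` [fset g i | i in 'I_m]%fset].
  move=> C [x Xx <-]; have [y xy By] := XB _ Xx.
  have [i _ Uy] := BU _ By; apply/imfsetP; exists i => //.
  rewrite /g; case: pselect => [e|[]]; last by exists y.
  case: (cid e) => y' /= [Uy' By'].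
  rewrite (delta_class_eq xy); apply: delta_class_eq.
  apply: (delta_equiv_step (y := y)); [apply: delta_equiv_refl; exact: BX|exact: BX|].
  exact: dU Uy Uy'.
have fin : finite_set (delta_components rho X dl) by apply: sub_finite_set sub _; exact: finite_fset.
split=> //; rewrite /num_delta_components.
apply: (@leq_trans #|` [fset g i | i in 'I_m]%fset|).
  apply: fsubset_leq_card; rewrite -[X in (_ `<=` X)%fset](set_fsetK (T := set T)) -fset_set_sub //.
by apply: leq_trans (leq_imfset_card _ _ _) _; rewrite /= -cardE card_ord.
Qed.

Lemma num_delta_components_le X dl m : Defs.covered_by rho X dl m ->
  finite_set (delta_components rho X dl) /\ (num_delta_components rho X dl <= m)%N.
Proof.
by apply: delta_components_cover => // x Xx; exists x => //; exact: delta_equiv_refl.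
Qed.

(** Finiteness guards against the default value: for an infinite set of components,
    [num_delta_components] is 0. *)
Lemma num_delta_components_ge (I : finType) X dl (p : I -> T) :
  finite_set (delta_components rho X dl) -> (forall i, X (p i)) ->
  (forall i j, delta_equiv rho X dl (p i) (p j) -> i = j) ->
  (#|I| <= num_delta_components rho X dl)%N.
Proof.
move=> fin Xp inj.
have pinj : injective (fun i => delta_equiv rho X dl (p i)).
  move=> i j /= e; apply: inj; rewrite e; exact: delta_equiv_refl.
have <- : #|` [fset delta_equiv rho X dl (p i) | i in I]%fset| = #|I|.
  by rewrite card_imfset //= -cardE.
apply: fsubset_leq_card; rewrite -[X in (X `<=` _)%fset](set_fsetK (T := set T)) -fset_set_sub //.
by move=> C /imfsetP[i _ ->]; exists (p i).
Qed.

Lemma covering_number_le X r m : Defs.covered_by rho X r m -> covering_number rho X r <= m%:R.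
Proof.
move=> Xm; apply: ge_inf; last by exists m.
by exists 0 => _ [m' _ <-].
Qed.

Lemma covering_number_ge X r (c : R) m0 : Defs.covered_by rho X r m0 ->
  (forall m, Defs.covered_by rho X r m -> c <= m%:R) -> c <= covering_number rho X r.
Proof.
move=> Xm0 H; apply: lb_le_inf; first by exists m0%:R; exists m0.
by move=> _ [m Xm <-]; exact: H.
Qed.

End CountComponents.

Section Eucl.
Context (R : realType) (d : nat).
Implicit Types x y : 'rV[R]_d.

Lemma eucl_distC x y : eucl_dist x y = eucl_dist y x.
Proof. by congr Num.sqrt; apply: eq_bigr => k _; rewrite -sqrrN opprB. Qed.

Lemma coord_le_eucl x y k : `|x ord0 k - y ord0 k| <= eucl_dist x y.
Proof.
rewrite -sqrtr_sqr ler_sqrt ?sumr_ge0 // => [|l _]; last exact: sqr_ge0.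
by rewrite (bigD1 k) //= lerDl sumr_ge0 // => l _; exact: sqr_ge0.
Qed.

Lemma eucl_dist_le x y r : 0 <= r -> (forall k, `|x ord0 k - y ord0 k| <= r) ->
  eucl_dist x y <= d%:R * r.
Proof.
move=> r0 H; have dr0 : 0 <= d%:R * r by rewrite mulr_ge0.
rewrite -[leRHS](ger0_norm dr0) -sqrtr_sqr ler_sqrt ?sqr_ge0 //.
apply: (@le_trans _ _ (\sum_(k < d) r ^+ 2)).
  apply: ler_sum => k _; rewrite -[leLHS]real_normK ?num_real //.
  by rewrite lerXn2r ?nnegrE.
rewrite sumr_const card_ord exprMn -[leLHS]mulr_natl ler_wpM2r ?sqr_ge0 //.
by rewrite -natrX ler_nat; case: (d) => // m; rewrite -{1}[m.+1]expn1 leq_pexp2l.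
Qed.

End Eucl.

(** * Approximate cells as sequences of partially forgotten digits *)

Section Codes.
Context (d : nat) (n : 'I_d -> nat) (D : {fset 'rV[nat]_d}).
Implicit Types (P Q : pred 'I_d) (k : 'I_d) (i : 'rV[nat]_d).

(** Forgotten digits become 0, so that the alphabets for all sets of coordinates live in one
    type. *)
Definition mask P i : 'rV[nat]_d := \row_k if P k then i ord0 k else 0%N.

Definition masked P : {fset 'rV[nat]_d} := [fset mask P i | i in D]%fset.

Lemma mask_eqP P i i' : mask P i = mask P i' <-> forall k, P k -> i ord0 k = i' ord0 k.
Proof.
split=> [/rowP H k Pk|H]; first by have := H k; rewrite !mxE Pk.
by apply/rowP => k; rewrite !mxE; case: ifP => // /H.
Qed.

Lemma eq_masked P Q : P =1 Q -> masked P = masked Q.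
Proof.
move=> PQ; apply: eq_imfset => //= i; apply/rowP => k.
by rewrite !mxE PQ.
Qed.

Definition level (M : nat) k := trunc_log (n k) M.

Definition active (M t : nat) : pred 'I_d := fun k => (t < level M k)%N.

Definition depth M := (\max_k level M k)%N.

Lemma level_depth M k : (level M k <= depth M)%N.
Proof. exact: leq_bigmax. Qed.

(** The alphabet varies with the place [t]. The alphabets [masked] give the approximate cells,
    smaller ones the cells along a face. *)
Definition code M (A : nat -> {fset 'rV[nat]_d}) : finType :=
  {dffun forall t : 'I_(depth M), A t}.

Lemma card_code M A : #|code M A| = (\prod_(t < depth M) #|` A t|)%N.
Proof.
rewrite card_dep_ffun foldrE big_map -big_enum; apply: eq_bigr => t _.
by rewrite cardfE.
Qed.

Definition num_cells M := (\prod_(t < depth M) #|` masked (active M t)|)%N.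

End Codes.

Section Cells.
Context (R : realType) (d : nat) (n : 'I_d -> nat) (hn2 : forall k, (2 <= n k)%N).
Context (D : {fset 'rV[nat]_d}) (hD : forall i, i \in D -> forall k : 'I_d, (i ord0 k < n k)%N).
Context (E : set 'rV[R]_d) (hE : is_sponge n D E).
Context (M : nat) (M0 : (0 < M)%N).
Implicit Types (a b : seq 'rV[nat]_d) (i : 'rV[nat]_d) (k : 'I_d) (x y z : 'rV[R]_d).

Lemma level_le k : (n k)%:R ^+ level n M k <= M%:R :> R.
Proof. by rewrite -natrX ler_nat trunc_logP. Qed.

Lemma level_gt k : M%:R < (n k)%:R ^+ (level n M k).+1 :> R.
Proof. by rewrite -natrX ltr_nat trunc_log_ltn. Qed.

Lemma take_digits a a' k : size a = depth n M -> size a' = depth n M ->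
  (forall t, (t < depth n M)%N -> active n M t k ->
    nth 0 a t ord0 k = nth 0 a' t ord0 k) ->
  map (fun i : 'rV[nat]_d => i ord0 k) (take (level n M k) a) =
  map (fun i : 'rV[nat]_d => i ord0 k) (take (level n M k) a').
Proof.
move=> sa sa' H.
have st c : size c = depth n M -> size (take (level n M k) c) = level n M k.
  by move=> sc; rewrite size_takel // sc level_depth.
apply: (@eq_from_nth _ 0%N); first by rewrite !size_map !st.
move=> t; rewrite size_map st // => tl.
rewrite !(nth_map 0) ?st // !nth_take //; apply: H => //.
exact: leq_trans tl (level_depth _ _ _).
Qed.

Lemma cell_diam a a' y y' k : size a = depth n M -> size a' = depth n M ->
  (forall t, (t < depth n M)%N -> active n M t k ->
    nth 0 a t ord0 k = nth 0 a' t ord0 k) ->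
  word_in D a -> word_in D a' -> E y -> E y' ->
  `|word_map n a y ord0 k - word_map n a' y' ord0 k| <= (nmax n)%:R / M%:R.
Proof.
move=> sa sa' H aD aD' Ey Ey'.
have st c : size c = depth n M -> size (take (level n M k) c) = level n M k.
  by move=> sc; rewrite size_takel // sc level_depth.
have dr c : word_in D c -> word_in D (drop (level n M k) c).
  by move=> cD; move: cD; rewrite -{1}(cat_take_drop (level n M k) c) all_cat => /andP[].
rewrite -(cat_take_drop (level n M k) a) -(cat_take_drop (level n M k) a') !word_map_cat.
apply: le_trans (word_map_close (k := k) hn2 hD hE _ _ _ _) _.
- by rewrite !st.
- by apply: word_pos_map; exact: take_digits.
- by apply: (sponge_word hE) => //; exact: dr.
- by apply: (sponge_word hE) => //; exact: dr.
rewrite st // ler_pdivlMr ?ltr0n // ler_pdivrMl ?(powE R hn2) //.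
apply: le_trans (ltW (level_gt k)) _.
rewrite exprSr; apply: ler_wpM2l; first by rewrite ltW ?(powE R hn2).
by rewrite ler_nat le_nmax.
Qed.

Lemma cover_codes (B : set 'rV[R]_d) (A : nat -> {fset 'rV[nat]_d}) :
  (forall x, B x -> exists a y, [/\ size a = depth n M, word_in D a, E y,
     x = word_map n a y &
     forall t, (t < depth n M)%N -> mask (active n M t) (nth 0 a t) \in A t]) ->
  Defs.covered_by (@eucl_dist R d) B (d%:R * ((nmax n)%:R / M%:R)) #|code n M A|.
Proof.
move=> HB.
pose U (v : code n M A) : set 'rV[R]_d := fun x => exists a y,
  [/\ size a = depth n M, word_in D a, E y, x = word_map n a y &
     forall t : 'I_(depth n M), mask (active n M t) (nth 0 a t) = val (v t)].
apply: (covered_by_fin (U := U)).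
  move=> v _ _ [a [y [sa aD Ey -> av]]] [a' [y' [sa' aD' Ey' -> av']]].
  apply: eucl_dist_le; first by rewrite divr_ge0.
  move=> k; apply: cell_diam => // t tL.
  by apply/mask_eqP: k; rewrite (av (Ordinal tL)) (av' (Ordinal tL)).
move=> x /HB[a [y [sa aD Ey xE aA]]].
have H (t : 'I_(depth n M)) : mask (active n M t) (nth 0 a t) \in A t by exact: aA.
exists [ffun t : 'I_(depth n M) => [` H t]%fset : A t] => //.
by exists a, y; split=> // t; rewrite ffunE.
Qed.

Lemma sponge_covered : Defs.covered_by (@eucl_dist R d) E
  (d%:R * ((nmax n)%:R / M%:R)) (num_cells n D M).
Proof.
have -> : num_cells n D M = #|code n M (fun t => masked D (active n M t))|.
  by rewrite card_code.
apply: cover_codes => x Ex.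
have [a [y [sa aD Ey xE]]] := sponge_coding hE (depth n M) Ex.
exists a, y; split=> // t tL; apply/imfsetP; exists (nth 0 a t) => //=.
by move/allP: aD; apply; rewrite mem_nth // sa.
Qed.

Definition cell := code n M (fun t => masked D (active n M t)).

Lemma card_cell : #|cell| = num_cells n D M.
Proof. by rewrite card_code. Qed.

Lemma cell_word : exists a : cell -> seq 'rV[nat]_d, forall v, [/\ size (a v) = depth n M,
  word_in D (a v) &
  forall t : 'I_(depth n M), mask (active n M t) (nth 0 (a v) t) = val (v t)].
Proof.
suff H (v : cell) : exists a, [/\ size a = depth n M, word_in D a &
    forall t : 'I_(depth n M), mask (active n M t) (nth 0 a t) = val (v t)].
  by have [a Ha] := choice H; exists a.
have [u Hu] : exists u : nat -> 'rV[nat]_d, forall t : 'I_(depth n M),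
    u t \in D /\ mask (active n M t) (u t) = val (v t).
  have H (t : nat) : exists i, forall tL : (t < depth n M)%N,
      i \in D /\ mask (active n M t) i = val (v (Ordinal tL)).
    case: (pselect (t < depth n M)%N) => [tL|ntL]; last by exists 0 => tL; case: ntL.
    have /imfsetP[i /= iD iE] := fsvalP (v (Ordinal tL)).
    by exists i => tL'; rewrite (bool_irrelevance tL' tL); split.
  have {H}[u Hu] := choice H.
  by exists u => -[t tL]; exact: Hu.
exists (mkseq u (depth n M)); split.
- by rewrite size_mkseq.
- apply/allP => i /mapP[t]; rewrite mem_iota add0n => /= tL ->.
  by have [] := Hu (Ordinal tL).
- by move=> t; rewrite nth_mkseq //; have [] := Hu t.
Qed.

Lemma cell_eq (a a' : seq 'rV[nat]_d) (v v' : cell) :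
  (forall t : 'I_(depth n M), mask (active n M t) (nth 0 a t) = val (v t)) ->
  (forall t : 'I_(depth n M), mask (active n M t) (nth 0 a' t) = val (v' t)) ->
  (forall k t, (t < level n M k)%N -> nth 0 a t ord0 k = nth 0 a' t ord0 k) -> v = v'.
Proof.
move=> va va' H; apply/ffunP => t; apply: val_inj.
by rewrite /= -va -va'; apply/mask_eqP => k; exact: H.
Qed.

(* A set of diameter at most [1 / M] only meets cells whose integer positions
   differ by at most 2, so positions modulo 3 separate them. *)
Lemma num_cells_cover m : Defs.covered_by (@eucl_dist R d) E M%:R^-1 m ->
  (num_cells n D M <= m * 3 ^ d)%N.
Proof.
move=> [U [dU EU]].
have [[x0 Ex0] _ _] := hE.
have [a Ha] := cell_word.
pose x v := word_map n (a v) x0.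
have Ex v : E (x v) by apply: (sponge_word hE) => //; have [] := Ha v.
have xU v : exists c : 'I_m, U c (x v) by have [c _ Uc] := EU _ (Ex v); exists c.
have {xU}[c Hc] := choice xU.
pose f v := (c v, [ffun k => inord (word_pos n k (take (level n M k) (a v)) %% 3) : 'I_3]).
suff inj : injective f.
  by rewrite -card_cell; apply: leq_trans (leq_card f inj) _; rewrite card_prod card_ffun !card_ord.
move=> v v' [cE /ffunP fE].
have [sa aD av] := Ha v; have [sa' aD' av'] := Ha v'.
apply: (cell_eq av av') => k t tl.
have := fE k; rewrite !ffunE => /(congr1 val); rewrite !val_insubd !ltn_pmod //= => mE.
have st c' : size c' = depth n M -> size (take (level n M k) c') = level n M k.
  by move=> sc; rewrite size_takel // sc level_depth.
have wtd c' : word_in D c' -> word_in D (take (level n M k) c') /\ word_in D (drop (level n M k) c').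
  by move=> cD; move: cD; rewrite -{1}(cat_take_drop (level n M k) c') all_cat => /andP[].
have [tD dD] := wtd _ aD; have [tD' dD'] := wtd _ aD'.
have pE : word_pos n k (take (level n M k) (a v)) = word_pos n k (take (level n M k) (a v')).
  have Ud : eucl_dist (x v) (x v') <= M%:R^-1.
    by apply: (dU (c v)); [exact: Hc|rewrite cE; exact: Hc].
  have := le_trans (coord_le_eucl _ _ k) Ud.
  rewrite /x -{1}(cat_take_drop (level n M k) (a v)) -{1}(cat_take_drop (level n M k) (a v')).
  rewrite !word_map_cat; set y := word_map _ (drop _ (a v)) _; set y' := word_map _ (drop _ (a v')) _.
  have Ey : E y by exact: (sponge_word hE).
  have Ey' : E y' by exact: (sponge_word hE).
  have := sponge_cube hn2 hD hE k Ey; have := sponge_cube hn2 hD hE k Ey'.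
  move=> /andP[y0 y1] /andP[z0 z1] Hd.
  have := word_map_diff hn2 y y' k (etrans (st _ _ sa) (esym (st _ _ sa'))).
  rewrite st // => /(congr1 (fun r => `|r|)); rewrite normrM (gtr0_norm (powE R hn2 _ _)) => e.
  have : (n k)%:R ^+ level n M k * `|word_map n (take (level n M k) (a v)) y ord0 k -
      word_map n (take (level n M k) (a v')) y' ord0 k| <= 1.
    rewrite -[leRHS](@divff _ M%:R) ?pnatr_eq0 ?gtn_eqF //.
    by apply: ler_pM => //; exact: level_le.
  rewrite e ler_norml => /andP[h1 h2]; move: mE.
  have l1 : (word_pos n k (take (level n M k) (a v)) < (word_pos n k (take (level n M k) (a v'))).+3)%N.
    by rewrite -(ltr_nat R) -!natr1; lra.
  have l2 : (word_pos n k (take (level n M k) (a v')) < (word_pos n k (take (level n M k) (a v))).+3)%N.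
    by rewrite -(ltr_nat R) -!natr1; lra.
  by move: l1 l2; clear; lia.
have := word_pos_inj hn2 (word_in_digits hD tD) (word_in_digits hD tD')
  (etrans (st _ _ sa) (esym (st _ _ sa'))) pE.
move/(congr1 (fun s => nth 0%N s t)).
by rewrite !(nth_map 0) ?st // !nth_take.
Qed.

End Cells.

(** * Insertion of fixed words into a sequence of letters *)

Section InsertWords.
Context (T : eqType).
Implicit Types (u : nat -> T) (p l t : nat) (s : seq (nat * seq T)).

(* The letters [u 0, u 1, ...], with the word [W] inserted before the letter
   [u l] for each pair [(l, W)] of [s]. *)
Fixpoint insert_words u p s : seq T :=
  if s is (l, W) :: s' then [seq u t | t <- iota p (l - p)] ++ W ++ insert_words u l s'
  else [::].

Lemma insert_words_cat u p s1 s2 : insert_words u p (s1 ++ s2) =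
  insert_words u p s1 ++ insert_words u (last p (unzip1 s1)) s2.
Proof. by elim: s1 p => //= -[l W] s1 IH p; rewrite IH !catA. Qed.

Lemma size_insert_words u p s : path leq p (unzip1 s) ->
  (size (insert_words u p s) + p = last p (unzip1 s) + \sum_(c <- s) size c.2)%N.
Proof.
elim: s p => [|[l W] s IH] p /=; first by rewrite big_nil addn0.
move=> /andP[pl /IH e]; rewrite big_cons /= !size_cat size_map size_iota; lia.
Qed.

Lemma insert_words_inj (S : eqType) (g : T -> S) u u' p s : path leq p (unzip1 s) ->
  map g (insert_words u p s) = map g (insert_words u' p s) ->
  forall t, (p <= t < last p (unzip1 s))%N -> g (u t) = g (u' t).
Proof.
elim: s p => [|[l W] s IH] p /=; first by move=> _ _ t; rewrite ltnNge; case: leqP.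
move=> /andP[pl ps]; rewrite !map_cat => /eqP; rewrite eqseq_cat ?size_map //.
rewrite eqseq_cat ?size_map // => /andP[/eqP e1 /andP[_ /eqP e2]] t /andP[pt tl].
have [lt|tl'] := leqP l t; first by apply: (IH l) => //; rewrite lt.
have ti : (t - p < l - p)%N by lia.
have := congr1 (fun q => nth (g (u 0%N)) q (t - p)) e1.
by rewrite -!map_comp !(nth_map 0%N) ?size_iota //= nth_iota // subnKC.
Qed.

Lemma all_insert_words (P : pred T) u p s : path leq p (unzip1 s) ->
  (forall t, (t < last p (unzip1 s))%N -> P (u t)) ->
  (forall c, c \in s -> all P c.2) -> all P (insert_words u p s).
Proof.
elim: s p => //= -[l W] s IH p /= /andP[pl ps] Hu Hs.
rewrite !all_cat; apply/and3P; split.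
- apply/allP => x /mapP[t]; rewrite mem_iota => /andP[_ tl] ->; apply: Hu.
  have : (l <= last l (unzip1 s))%N.
    elim: (unzip1 s) (l) ps {IH Hs pl tl} => //= c q IHq e /andP[ec cq].
    exact: leq_trans ec (IHq _ cq).
  lia.
- by apply: (Hs (l, W)); rewrite mem_head.
- by apply: IH => // c cs; apply: Hs; rewrite inE cs orbT.
Qed.

End InsertWords.

(** * Lower bound from islands *)

Section Separation.
Context (R : realType) (d : nat) (n : 'I_d -> nat) (hn2 : forall k, (2 <= n k)%N).
Hypothesis hn : forall k l : 'I_d, (k < l)%N -> (n k < n l)%N.
Context (D : {fset 'rV[nat]_d}) (hD : forall i, i \in D -> forall k : 'I_d, (i ord0 k < n k)%N).
Context (E : set 'rV[R]_d) (hE : is_sponge n D E).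
Implicit Types (a b : seq 'rV[nat]_d) (k l : 'I_d) (x y z : 'rV[R]_d).

(** [U] avoids the faces, so the magnified point has a well-determined integer part in each
    coordinate of [J]. *)
Lemma island_copy_pos (J : pred 'I_d) U eta a b x : island E J U eta -> size a = size b ->
  island_copy n D J U a x -> island_copy n D J U b x ->
  forall k, J k -> word_pos n k a = word_pos n k b.
Proof.
move=> [eta0 _ UE _ Ubd] sab [a' [y [xE _ sa Uy ya]]] [b' [y' [xE' _ sb Uy' yb]]] k Jk.
rewrite -ya // -yb //.
have := word_map_diff hn2 y y' k (etrans sa (etrans sab (esym sb))).
rewrite -xE -xE' subrr mulr0.
have /andP[h1 h2] := Ubd _ _ Uy Jk; have /andP[h3 h4] := Ubd _ _ Uy' Jk.
move=> e; apply/eqP; rewrite eqn_leq -ltnS -[X in _ && X]ltnS -!(ltr_nat R) -!natr1.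
by apply/andP; split; lra.
Qed.

Lemma leq_nk k l : (k <= l)%N -> (n k <= n l)%N.
Proof.
rewrite leq_eqVlt => /orP[/eqP/val_inj->//|kl]; exact: ltnW (hn kl).
Qed.

Lemma level_anti M k l : (0 < M)%N -> (k <= l)%N -> (level n M l <= level n M k)%N.
Proof.
move=> M0 kl; apply: trunc_log_max => //.
apply: leq_trans (trunc_logP (hn2 l) M0); rewrite -/(level n M l).
have [->//|t0] := posnP (level n M l).
by rewrite leq_exp2r // leq_nk.
Qed.

(** The coordinates are reversed because [level n M k] decreases in [k], whereas [insert_words]
    expects increasing places. *)
Lemma sorted_levels (M : nat) : (0 < M)%N ->
  path leq 0 [seq level n M k | k <- rev (enum 'I_d)].
Proof.
move=> M0; rewrite path_min_sorted; last by apply/allP.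
rewrite sorted_map rev_sorted.
have : sorted (relpre val leq) (enum 'I_d).
  by rewrite -sorted_map val_enum_ord iota_sorted.
by apply: sub_sorted => k l /= kl; exact: level_anti.
Qed.

(* Inserting after the first [level k] letters of a word, for each [k], a word
   leading into the island for the coordinates [0, ..., k] costs a bounded factor
   in scale; the points so obtained in distinct cells are then separated, since a
   chain of small step cannot leave the copy of any of these islands. *)
Lemma islands_separated (U : 'I_d -> set 'rV[R]_d) (eta : 'I_d -> R) :
  (forall k, island E (upto k) (U k) (eta k)) ->
  exists2 c0 : R, 0 < c0 & forall M, (0 < M)%N -> forall dl, dl <= c0 / M%:R ->
  exists p : cell n D M -> 'rV[R]_d, (forall v, E (p v)) /\
    forall v v', delta_equiv (@eucl_dist R d) E dl (p v) (p v') -> v = v'.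
Proof.
move=> isl.
have [[x0 Ex0] _ _] := hE.
have [W HW] := choice (fun k => island_word hn2 hD hE (isl k)).
pose S := (\sum_k size (W k))%N.
have [r r0 Hr] := @finite_pos_lb R _ predT eta (fun k _ => let: And5 e _ _ _ _ := isl k in e).
have [k0 _|d0] := pickP (@predT 'I_d); last first.
  exists 1 => // M M0 dl _; have [a Ha] := @cell_word d n D M.
  exists (fun v => x0); split=> // v v' _.
  have [_ _ h] := Ha v; have [_ _ h'] := Ha v'.
  by apply: (cell_eq h h') => k; have := d0 k.
have K0n : (0 < nmax n)%N by apply: leq_trans (le_nmax n k0); exact: ltnW (hn2 k0).
have K0 : 0 < (nmax n)%:R :> R.
  by rewrite ltr0n; apply: leq_trans (le_nmax n k0); exact: ltnW (hn2 k0).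
(* At most [S] letters are inserted, so they cost at most the factor [nmax n ^ S] in scale; the half
   provides the strict inequality of [island_copy_gap]. *)
exists (r / 2 / (nmax n)%:R ^+ S); first by rewrite !divr_gt0 // exprn_gt0.
move=> M M0 dl dlM.
have [a Ha] := @cell_word d n D M.
pose s := [seq (level n M k, W k) | k <- rev (enum 'I_d)].
have us : unzip1 s = [seq level n M k | k <- rev (enum 'I_d)].
  by rewrite /unzip1 -map_comp.
have ps : path leq 0 (unzip1 s) by rewrite us sorted_levels.
pose w v := insert_words (nth 0 (a v)) 0 s.
have wD v : word_in D (w v).
  have [sa aD _] := Ha v.
  apply: all_insert_words ps _ _ => [t tl|c /mapP[k _ ->] /=]; last by have [] := HW k.
  move/allP: aD; apply; rewrite mem_nth // sa; apply: leq_trans tl _.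
  have := mem_last 0%N (unzip1 s); rewrite inE us => /orP[/eqP->//|/mapP[k _ ->]].
  exact: level_depth.
have Ep v : E (word_map n (w v) x0) by exact: (sponge_word hE).
exists (fun v => word_map n (w v) x0); split=> // v v' vv'.
have [sa aD av] := Ha v; have [sa' aD' av'] := Ha v'.
apply: (cell_eq av av') => k t tl.
have [s1 [s2 sE]] : exists s1 s2, s = s1 ++ (level n M k, W k) :: s2.
  have : k \in rev (enum 'I_d) by rewrite mem_rev mem_enum.
  rewrite /s => /path.splitPr[t1 t2].
  by exists [seq (level n M k, W k) | k <- t1], [seq (level n M k, W k) | k <- t2]; rewrite map_cat.
(* The empty word at the end makes this prefix stop right before the inserted [W k]. *)
pose A u := insert_words u 0 (s1 ++ [:: (level n M k, [::] : seq 'rV[nat]_d)]).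
have wE u : insert_words u 0 s = A u ++ W k ++ insert_words u (level n M k) s2.
  by rewrite sE /A !insert_words_cat /= cats0 -!catA.
have pA : path leq 0 (unzip1 (s1 ++ [:: (level n M k, [::] : seq 'rV[nat]_d)])).
  move: ps; rewrite sE /unzip1 !map_cat !cat_path /= => /andP[-> /andP[-> _]] //.
have lastA : last 0%N (unzip1 (s1 ++ [:: (level n M k, [::] : seq 'rV[nat]_d)])) = level n M k.
  by rewrite /unzip1 map_cat last_cat.
have sumS : (\sum_(c <- s) size c.2 = S)%N.
  by rewrite /s big_map /= (perm_big (enum 'I_d)) ?perm_rev // big_enum.
have sA u : (size (A u) <= level n M k + S)%N.
  have := size_insert_words u pA; rewrite addn0 lastA -/(A u) => ->.
  by rewrite leq_add2l -sumS sE !big_cat /= !big_cons big_nil /= addn0 leq_add2l.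
have sAA u u' : size (A u) = size (A u').
  by have := size_insert_words u pA; have := size_insert_words u' pA; rewrite !addn0 => -> ->.
have ADa u : word_in D (insert_words u 0 s) -> word_in D (A u).
  by rewrite wE all_cat => /andP[].
have copy v1 : island_copy n D (upto k) (U k) (A (nth 0 (a v1))) (word_map n (w v1) x0).
  have := wD v1; rewrite /w wE !all_cat => /and3P[AD WD rD].
  exists (A (nth 0 (a v1))), (word_map n (W k ++ insert_words (nth 0 (a v1)) (level n M k) s2) x0).
  split=> //; first by rewrite -word_map_cat.
  rewrite word_map_cat; have [_ _ HU] := HW k; apply: HU; exact: (sponge_word hE).
have : island_copy n D (upto k) (U k) (A (nth 0 (a v))) (word_map n (w v') x0).
  apply: delta_equiv_inv vv'; last exact: copy.
  move=> x y _ Ey xy cx; apply: (island_copy_gap hn2 hD hE (isl k) cx Ey) => l lk.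
  apply: le_lt_trans (coord_le_eucl x y l) _; apply: le_lt_trans xy _.
  apply: le_lt_trans dlM _.
  apply: (@lt_le_trans _ _ (r / ((nmax n)%:R ^+ S * M%:R))).
    rewrite invfM !mulrA ltr_pM2r ?invr_gt0 ?ltr0n // ltr_pM2r ?invr_gt0 ?exprn_gt0 //.
    by rewrite gtr_pMr // invf_lt1 ?ltr1n.
  apply: ler_pM; rewrite ?invr_ge0 ?(ltW r0) ?mulr_ge0 ?exprn_ge0 //; first exact: Hr.
  rewrite lef_pV2 ?posrE ?mulr_gt0 ?exprn_gt0 ?ltr0n // ?(ltnW (hn2 l)) //.
  (* Here [l <= k] is essential: the prefix magnifies coordinate [l] no more than coordinate [k],
     that is, by at most [M * nmax n ^ S]. *)
  apply: (@le_trans _ _ ((n k)%:R ^+ (level n M k + S))).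
    apply: (@le_trans _ _ ((n k)%:R ^+ size (A (nth 0 (a v))))).
      by rewrite lerXn2r ?nnegrE // ler_nat leq_nk.
    by rewrite ler_eXn2l // ltr1n hn2.
  rewrite exprD mulrC; apply: ler_pM; rewrite ?exprn_ge0 //.
    exact: pow_le_nmax.
  exact: level_le.
move/(island_copy_pos (isl k) (sAA _ _)) => /(_ _ (copy v') k (leqnn k)) posE.
have := word_pos_inj hn2 (word_in_digits hD (ADa _ (wD v))) (word_in_digits hD (ADa _ (wD v')))
  (sAA _ _) posE.
move/(insert_words_inj (g := fun i : 'rV[nat]_d => i ord0 k) pA) => /(_ t).
by rewrite lastA tl; apply.
Qed.

End Separation.

(** * Growth of the number of cells *)

Section Growth.
Context (R : realType) (d : nat) (n : 'I_d -> nat) (hn2 : forall k, (2 <= n k)%N).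
Hypothesis hn : forall k l : 'I_d, (k < l)%N -> (n k < n l)%N.
Context (D : {fset 'rV[nat]_d}) (D2 : (2 <= #|` D|)%N).
Implicit Types (k l : 'I_d) (P Q : pred 'I_d).

Definition below (j : nat) : pred 'I_d := fun k => (k < j)%N.

Let N j := #|` masked D (below j)|.

(** Average number of extensions of a digit from the coordinates below [k] to coordinate [k]. With
    it, [sponge_dim] is the classical formula for the box dimension of a self-affine sponge. *)
Definition growth k : R := (N k.+1)%:R / (N k)%:R.

Definition sponge_dim : R := \sum_k ln (growth k) / ln (n k)%:R.

Lemma masked_gt0 P : (0 < #|` masked D P|)%N.
Proof.
have /fset0Pn[i iD] : D != fset0 by rewrite -cardfs_gt0; apply: leq_trans D2.
by rewrite cardfs_gt0; apply/fset0Pn; exists (mask P i); apply/imfsetP; exists i.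
Qed.

Lemma masked_sub P Q : (forall k, P k -> Q k) -> (#|` masked D P| <= #|` masked D Q|)%N.
Proof.
move=> PQ; apply: (@leq_trans #|` [fset mask P i | i in masked D Q]%fset|); last first.
  exact: leq_imfset_card.
apply: fsubset_leq_card; apply/fsubsetP => _ /imfsetP[i /= iD ->].
apply/imfsetP; exists (mask Q i) => /=; first by apply/imfsetP; exists i.
by apply/mask_eqP => k /PQ Qk; rewrite mxE Qk.
Qed.

Lemma growth_ge1 k : 1 <= growth k.
Proof.
rewrite ler_pdivlMr ?ltr0n ?masked_gt0 // mul1r ler_nat masked_sub // => l.
exact: ltnW.
Qed.

Lemma growth_gt0 k : 0 < growth k.
Proof. by apply: lt_le_trans (growth_ge1 k). Qed.

Lemma masked_below j : (j <= d)%N -> (N j)%:R = \prod_(k | below j k) growth k.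
Proof.
elim: j => [_|j IH jd].
  rewrite big_pred0 // /N; apply/eqP; rewrite -[1]/(1%:R) eqr_nat eqn_leq masked_gt0 andbT.
  apply: leq_trans (eq_leq (cardfs1 (0 : 'rV[nat]_d))); apply: fsubset_leq_card; apply/fsubsetP => _ /imfsetP[i _ ->].
  by rewrite inE; apply/eqP/rowP => k; rewrite !mxE.
rewrite (bigD1 (Ordinal jd)) /=; last exact: ltnSn.
rewrite (eq_bigl (below j)); last first.
  by move=> k; rewrite /below ltnS ltn_neqAle andbC -val_eqE.
rewrite -IH; last exact: ltnW.
by rewrite /growth /= divfK // pnatr_eq0 -lt0n masked_gt0.
Qed.

Lemma active_below M t : (0 < M)%N ->
  exists2 j, (j <= d)%N & active n M t =1 below j.
Proof.
move=> M0; have [/existsP[k0 nk0]|] := boolP [exists k, ~~ active n M t k]; last first.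
  rewrite negb_exists => /forallP H; exists d => // k; rewrite /below ltn_ord.
  by have := H k; rewrite negbK.
case: (@arg_minnP _ k0 (fun k => ~~ active n M t k) (fun k : 'I_d => val k) nk0) => k nk Hk.
exists k; first exact: ltnW (ltn_ord k).
move=> l; rewrite /below; have [lk|kl] := ltnP l k.
  by apply: contraTT lk => nl; rewrite -leqNgt; exact: Hk.
apply/negbTE; move: nk; rewrite /active -!leqNgt; apply: leq_trans.
exact: level_anti.
Qed.

Lemma masked_active M t : (0 < M)%N ->
  #|` masked D (active n M t)|%:R = \prod_(k | active n M t k) growth k.
Proof.
move=> M0; have [j jd aj] := active_below t M0.
by rewrite (eq_masked _ aj) (eq_bigl _ _ aj) -masked_below.
Qed.

(** The size of each alphabet telescopes into growth factors; coordinate [k] contributes one at each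
    of its [level n M k] places. *)
Lemma num_cells_growth M : (0 < M)%N ->
  (num_cells n D M)%:R = \prod_k growth k ^+ level n M k.
Proof.
move=> M0; rewrite /num_cells natr_prod.
under eq_bigr do rewrite masked_active // big_mkcond.
rewrite exchange_big; apply: eq_bigr => k _.
rewrite -big_mkcond -(big_ord_widen _ (fun=> growth k)) ?level_depth //.
by rewrite prodr_const card_ord.
Qed.

Lemma growth_all : \prod_k growth k = #|` D|%:R.
Proof.
rewrite (eq_bigl (below d)); last by move=> k; rewrite /below ltn_ord.
rewrite -masked_below // /N; congr (_%:R); rewrite /masked card_in_imfset //.
move=> i i' _ _ /mask_eqP H; apply/rowP => k.
by apply: H; exact: ltn_ord.
Qed.

Let ln_n_gt0 k : 0 < ln (n k)%:R :> R.
Proof. by rewrite ln_gt0 // ltr1n hn2. Qed.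

Let s k : R := ln (growth k) / ln (n k)%:R.

Lemma growth_exp_ge0 k : 0 <= s k.
Proof. by rewrite divr_ge0 ?(ltW (ln_n_gt0 _)) // ln_ge0 // growth_ge1. Qed.

Lemma growthE k : growth k = (n k)%:R `^ s k.
Proof.
have n0 := nk_gt0 R hn2 k.
rewrite /powR gt_eqF // /s divfK ?gt_eqF ?ln_n_gt0 // lnK // posrE; exact: growth_gt0.
Qed.

Lemma powR_sponge_dim (M : nat) : (0 < M)%N -> M%:R `^ sponge_dim = \prod_k M%:R `^ s k.
Proof.
move=> M0; have Mn : M%:R != 0 :> R by rewrite pnatr_eq0 -lt0n.
have H x y : M%:R `^ (x + y) = M%:R `^ x * M%:R `^ y :> R by rewrite powRD // Mn implybT.
exact: (big_morph (powR M%:R) H (powRr0 _)).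
Qed.

Lemma num_cells_le M : (0 < M)%N -> (num_cells n D M)%:R <= M%:R `^ sponge_dim.
Proof.
move=> M0; rewrite num_cells_growth // powR_sponge_dim //; apply: ler_prod => k _.
rewrite exprn_ge0 ?(ltW (growth_gt0 k)) //= growthE -powR_mulrn ?powR_ge0 // powRAC.
apply: ge0_ler_powR; rewrite ?growth_exp_ge0 ?nnegrE ?powR_ge0 //.
rewrite powR_mulrn //; exact: level_le.
Qed.

(** Rounding the level up instead of down costs one factor [growth k] per coordinate; their product
    is the cardinality of [D]. *)
Lemma num_cells_ge M : (0 < M)%N ->
  M%:R `^ sponge_dim <= #|` D|%:R * (num_cells n D M)%:R.
Proof.
move=> M0; rewrite num_cells_growth // powR_sponge_dim // -growth_all -big_split /=.
apply: ler_prod => k _; rewrite powR_ge0 /= -exprS growthE -powR_mulrn ?powR_ge0 // powRAC.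
apply: ge0_ler_powR; rewrite ?growth_exp_ge0 ?nnegrE ?powR_ge0 //.
rewrite powR_mulrn //; apply: ltW; exact: level_gt.
Qed.

Lemma sponge_dim_gt0 : 0 < sponge_dim.
Proof.
rewrite lt_neqAle sumr_ge0 ?andbT; last by move=> k _; exact: growth_exp_ge0.
apply/eqP => s0.
have H := psumr_eq0P (fun k _ => growth_exp_ge0 k) (esym s0).
have := growth_all; rewrite big1 => [/eqP|k _]; last by rewrite growthE H // powRr0.
by rewrite -[1]/(1%:R) eqr_nat => /eqP D1; move: D2; rewrite -D1.
Qed.

End Growth.

(** * Upper bound in the absence of islands *)

(** It suffices that [a ^ (a * a + 1) <= a.+1 ^ (a * a)]: this is the [a]-th power of
    [2 * a ^ a <= a.+1 ^ a], combined with [a <= 2 ^ a]. *)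
Lemma expn_gap (a b g : nat) : (0 < a)%N -> (a < b)%N ->
  (a ^ (a * a * g + g) <= b ^ (a * a * g))%N.
Proof.
move=> a0 ab.
have H m : (a ^ m * (a + m) <= a * a.+1 ^ m)%N.
  elim: m => [|m IH]; first by rewrite !expn0 mul1n muln1 addn0.
  rewrite !expnS; apply: (@leq_trans (a.+1 * (a ^ m * (a + m)))); last by nia.
  rewrite -mulnA mulnCA [leqRHS]mulnCA leq_pmul2l ?expn_gt0 ?a0 //; nia.
have H2 : (2 * a ^ a <= a.+1 ^ a)%N.
  rewrite -(leq_pmul2l a0); apply: leq_trans (H a).
  by rewrite addnn -mul2n mulnCA [leqRHS]mulnC -mulnA.
rewrite -{2}[g]mul1n -mulnDl !(expnM _ _ g).
case: g => [|g]; first by rewrite !expn0.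
rewrite leq_exp2r // addn1 expnS.
apply: (@leq_trans (a.+1 ^ (a * a))); last by rewrite leq_exp2r ?muln_gt0 ?a0.
rewrite !expnM; apply: (@leq_trans ((2 * a ^ a) ^ a)); last by rewrite leq_exp2r.
by rewrite expnMn leq_mul2r ltnW ?orbT // ltn_expl.
Qed.

Section NoIsland.
Context (R : realType) (d : nat) (n : 'I_d -> nat) (hn2 : forall k, (2 <= n k)%N).
Hypothesis hn : forall k l : 'I_d, (k < l)%N -> (n k < n l)%N.
Context (D : {fset 'rV[nat]_d}) (D2 : (2 <= #|` D|)%N).
Hypothesis hD : forall i, i \in D -> forall k : 'I_d, (i ord0 k < n k)%N.
Context (E : set 'rV[R]_d) (hE : is_sponge n D E) (nd : ~ degenerated E).
Implicit Types (a b : seq 'rV[nat]_d) (k l : 'I_d) (x y z : 'rV[R]_d).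

Lemma coord_dist_le_norm J x y : coord_dist J x y <= `|x - y|.
Proof.
apply/coord_dist_leP => // k _.
by have /row_norm_leP /(_ k) := lexx `|x - y|; rewrite !mxE; apply.
Qed.

(** Otherwise compactness would give [C] a uniform distance to the faces, making it an island. *)
Lemma gapped_meets_bdry (J : pred 'I_d) (C : set 'rV[R]_d) eta :
  ~ (exists U e, island E J U e) -> C !=set0 -> C `<=` E -> 0 < eta ->
  (forall x y, C x -> E y -> coord_dist J x y <= eta -> C y) ->
  exists x k (b : bool), [/\ C x, J k & x ord0 k = b%:R].
Proof.
move=> nI C0 CE eta0 Cgap; apply: contrapT => nb; apply: nI; exists C.
have [_ cE _] := hE.
pose m x k := Num.min (x ord0 k) (1 - x ord0 k).
have m_gt0 x k : C x -> J k -> 0 < m x k.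
  move=> Cx Jk; have /andP[x0 x1] := sponge_cube hn2 hD hE k (CE _ Cx).
  rewrite lt_min subr_gt0 !lt_neqAle x0 x1 !andbT; apply/andP; split; apply/eqP => e; apply: nb.
    by exists x, k, false.
  by exists x, k, true.
have H k : exists e, 0 < e /\ (J k -> forall x, C x -> e <= m x k).
  have [Jk|nJk] := boolP (J k); last by exists 1; split=> // Jk; rewrite Jk in nJk.
  apply: contrapT => H.
  have {}H (t : nat) : exists x, C x /\ m x k < t.+1%:R^-1.
    apply: contrapT => H'; apply: H; exists t.+1%:R^-1; split; first by rewrite invr_gt0.
    by move=> _ x Cx; rewrite leNgt; apply/negP => lt; apply: H'; exists x.
  have {H}[u Hu] := choice H.
  have [x Ex ux] := compact_seq_cluster cE (fun t => CE _ (proj1 (Hu t))).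
  have Cx : C x.
    have [t _ tx] := ux _ 0%N eta0; have [Cu _] := Hu t.
    apply: Cgap Cu Ex _; exact: le_trans (coord_dist_le_norm _ _ _) (ltW tx).
  have m0 := m_gt0 _ _ Cx Jk.
  have m20 : 0 < m x k / 2 by rewrite divr_gt0.
  have [N HN] := invr_nat_lt m20.
  have [t Nt tx] := ux _ N m20; have [_ mu] := Hu t.
  have := le_lt_trans (le_trans (coord_le_dist (u t) x Jk) (coord_dist_le_norm _ _ _)) tx.
  have := lt_trans mu (HN _ Nt).
  have [] : m x k <= x ord0 k /\ m x k <= 1 - x ord0 k.
    by rewrite /m; split; rewrite ge_min lexx ?orbT.
  move: (m x k) => mx h1 h2; rewrite /m gt_min => /orP[] h3; rewrite ltr_norml => /andP[]; lra.
have {H}[e He] := choice H.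
have [r r0 Hr] := @finite_pos_lb R _ J e (fun k _ => proj1 (He k)).
exists (Num.min eta r); split=> //.
- by rewrite lt_min eta0.
- move=> x y Cx Ey xy; apply: Cgap Cx Ey _; apply: le_trans xy _.
  by rewrite ge_min lexx.
- move=> x k Cx Jk; have [_ /(_ Jk _ Cx)] := He k.
  have := Hr _ Jk; have : Num.min eta r <= r by rewrite ge_min lexx orbT.
  rewrite /m le_min => h1 h2 /andP[h3 h4]; apply/andP; split; lra.
Qed.

Lemma covered_by_le (T : choiceType) (rho : T -> T -> R) X r m m' : (m <= m')%N ->
  Defs.covered_by rho X r m -> Defs.covered_by rho X r m'.
Proof.
move=> mm [U [dU XU]].
exists (fun i => if insub (val i) is Some i' then U i' else set0); split.
  by move=> i x y; case: insubP => [i' _ _|_ []]; exact: dU.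
move=> x /XU[i _ Ux]; exists (widen_ord mm i) => //=.
by rewrite valK.
Qed.

Lemma covered_by_bigcup (T : choiceType) (rho : T -> T -> R) (I : finType)
    (X : I -> set T) r m : (forall i, Defs.covered_by rho (X i) r m) ->
  Defs.covered_by rho (\bigcup_i X i) r (#|I| * m).
Proof.
move=> H; have {H}[U HU] := choice H.
have -> : (#|I| * m = #|{: I * 'I_m}|)%N by rewrite card_prod card_ord.
apply: (covered_by_fin (U := fun q => U q.1 q.2)).
  by move=> [i c] x y /=; have [dU _] := HU i; exact: dU.
move=> x [i _ Xx]; have [_ /(_ _ Xx)[c _ Ux]] := HU i.
by exists (i, c).
Qed.

Definition face_digits M k (b : bool) p q t : {fset 'rV[nat]_d} :=
  if (p <= t < q)%N then
    [fset mask (active n M t) i | i in D & i ord0 k == (b * (n k).-1)%N]%fset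
  else masked D (active n M t).

(** Non-degeneracy provides a digit off the face; its mask is lost, as coordinate [k] is still
    active in the window. *)
Lemma card_face_digits M k (b : bool) p q t : (q <= level n M k)%N ->
  (#|` face_digits M k b p q t| <= #|` masked D (active n M t)| - (p <= t < q))%N.
Proof.
move=> qk; rewrite /face_digits; case: ifP => [/andP[pt tq]|_]; last by rewrite subn0.
have [i0 iD i0k] := nondegenerate_digit hn2 hD hE b k nd.
have i0m : mask (active n M t) i0 \in masked D (active n M t) by apply/imfsetP; exists i0.
rewrite [X in (_ <= X - _)%N](cardfsD1 (mask (active n M t) i0)) i0m add1n subn1 /=.
apply: fsubset_leq_card; apply/fsubsetP => u /imfsetP[i /= + ->].
rewrite inE => /andP[iD' /eqP ik]; rewrite !inE; apply/andP; split; last first.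
  by apply/imfsetP; exists i.
apply/eqP => /mask_eqP H; move: i0k; rewrite -ik -H ?eqxx //.
exact: leq_trans tq qk.
Qed.

(** An alphabet has at most as many letters as [D], so losing one letter shrinks it at least by this
    factor. *)
Let theta : R := 1 - #|` D|%:R^-1.

Lemma prod_window (c : R) p q L : (p <= q)%N -> (q <= L)%N ->
  \prod_(t < L) (if (p <= t < q)%N then c else 1) = c ^+ (q - p).
Proof.
move=> pq qL; rewrite -(big_mkord xpredT (fun t => if (p <= t < q)%N then c else 1)).
rewrite (big_cat_nat (n := p)) ?(leq_trans pq) //= [X in _ * X](big_cat_nat (n := q)) //=.
rewrite [X in X * _]big_nat_cond [X in X * _]big1 ?mul1r; last first.
  by move=> t; rewrite andbT => /andP[_ tp]; rewrite leqNgt tp.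
rewrite [X in _ * X]big_nat_cond [X in _ * X]big1 ?mulr1; last first.
  by move=> t; rewrite andbT => /andP[qt _]; rewrite [(t < q)%N]ltnNge qt andbF.
by rewrite -prodr_const_nat; apply: eq_big_nat => t ->.
Qed.

(** After [p] letters the coordinates above [k] are known to order [1 / M], so moves in them are
    free. Inside a cell of length [p], a chain class is therefore gapped for [upto k] alone and has
    to meet a face. *)
Lemma components_no_island k M p : ~ (exists U e, island E (upto k) U e) ->
  (0 < M)%N -> (p <= level n M k)%N ->
  (forall l, (k < l)%N -> (M < n l ^ p.+1)%N) ->
  (num_delta_components (@eucl_dist R d) E (d%:R * ((nmax n)%:R / M%:R)))%:R <=
    (d * 2)%:R * (theta ^+ (level n M k - p) * (num_cells n D M)%:R).
Proof.
move=> nI M0 pk Hp.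
set dl := d%:R * _.
(* The points that land on a given face after removal of their first [p] letters; there are [d * 2]
   faces. *)
pose B (q : 'I_d * bool) : set 'rV[R]_d := fun x => (q.1 <= k)%N /\ exists a y,
  [/\ size a = p, word_in D a, E y, y ord0 q.1 = q.2%:R & x = word_map n a y].
pose X := (\prod_(t < depth n M) (#|` masked D (active n M t)| - (p <= t < level n M k)))%N.
have Bcov q : Defs.covered_by (@eucl_dist R d) (B q) dl X.
  case: q => l b.
  have [lk|kl] := leqP l k; last first.
    apply: (@covered_by_le _ _ _ _ 0) => //; exists (fun=> set0); split=> //.
    by move=> x [/=]; rewrite leqNgt kl.
  apply: (@covered_by_le _ _ _ _ #|code n M (face_digits M l b p (level n M k))|).
    rewrite card_code; apply: leq_prod => t _; apply: card_face_digits.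
    exact: level_anti.
  apply: (cover_codes hn2 hD hE M0) => x [_ [a [y [sa aD Ey yl ->]]]] /=.
  have [b' [y' [sb bD Ey' yE]]] := sponge_coding hE (depth n M - p) Ey.
  have sz : size (a ++ b') = depth n M.
    by rewrite size_cat sa sb subnKC // (leq_trans pk) // level_depth.
  exists (a ++ b'), y'; split=> //.
  - by rewrite all_cat aD.
  - by rewrite word_map_cat -yE.
  - have abD : word_in D (a ++ b') by rewrite all_cat aD.
    move=> t tL; rewrite /face_digits; case: ifP => [/andP[pt tk]|_]; last first.
      apply/imfsetP; exists (nth 0 (a ++ b') t) => //=.
      by move/allP: abD; apply; rewrite mem_nth // sz.
    apply/imfsetP; exists (nth 0 (a ++ b') t) => //=; rewrite inE; apply/andP; split.
      by move/allP: abD; apply; rewrite mem_nth // sz.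
    rewrite nth_cat sa ltnNge pt /=; apply/eqP.
    rewrite yE in yl; apply: (word_face_digit hn2 hD hE bD Ey' yl).
    by rewrite mem_nth // sb ltn_sub2r // (leq_ltn_trans pt tL).
have fin := delta_components_cover (@eucl_distC R d) (X := E) _ _ (covered_by_bigcup Bcov).
have [||_ num] := fin.
- move=> x [[l b] _ [_ [a [y [_ aD Ey _ ->]]]]]; exact: (sponge_word hE).
- move=> x Ex; have [a [x' [sa aD Ex' xE]]] := sponge_coding hE p Ex.
  pose C y := E y /\ delta_equiv (@eucl_dist R d) E dl x (word_map n a y).
  have eta0 : 0 < (nmax n)%:R / M%:R :> R.
    rewrite divr_gt0 ?ltr0n //; apply: leq_trans (le_nmax n k); exact: ltnW (hn2 k).
  have [|||y [l [b [[Ey xy] lk yl]]]] := gapped_meets_bdry (C := C) nI _ _ eta0.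
  + by exists x'; split=> //; rewrite -xE; exact: delta_equiv_refl.
  + by move=> y [].
  + move=> y y' [Ey xy] Ey' yy'; split=> //.
    apply: delta_equiv_step xy (sponge_word hE aD Ey') _.
    apply: eucl_dist_le; first exact: ltW.
    move=> l; have [lk|kl] := leqP l k.
      apply: (@le_trans _ _ ((nmax n)%:R / M%:R / (n l)%:R ^+ size a)).
        apply: word_map_dist => //.
        by rewrite opprD addrACA subrr add0r; apply: le_trans (coord_le_dist y y' lk) yy'.
      rewrite ler_pdivrMr ?(powE R hn2) // ler_peMr ?(ltW eta0) // exprn_ege1 // ler1n.
      exact: ltnW (hn2 l).
    apply: le_trans (word_map_close hn2 hD hE (erefl _) (erefl _) Ey Ey') _.
    rewrite sa ler_pdivlMr ?ltr0n // ler_pdivrMl ?(powE R hn2) //.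
    have := ltnW (Hp _ kl); rewrite -(ler_nat R) natrX exprSr => /le_trans; apply.
    by apply: ler_wpM2l; rewrite ?exprn_ge0 // ler_nat le_nmax.
  exists (word_map n a y) => //.
  by exists (l, b) => //; split=> //; exists a, y.
apply: (@le_trans _ _ ((#|{: 'I_d * bool}| * X)%N%:R)); first by rewrite ler_nat.
rewrite natrM card_prod card_ord card_bool ler_wpM2l //.
rewrite -(prod_window theta pk (level_depth n M k)) /num_cells /X !natr_prod -big_split /=.
apply: ler_prod => t _; rewrite ler0n /=; case: ifP => _; last by rewrite subn0 mul1r.
have N0 : (0 < #|` masked D (active n M t)|)%N by exact: masked_gt0.
have ND : (#|` masked D (active n M t)| <= #|` D|)%N by exact: leq_imfset_card.
rewrite natrB //= /theta mulrBl mul1r lerD2l lerN2 mulrC ler_pdivrMr ?mul1r ?ler_nat //.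
by rewrite ltr0n; apply: leq_trans ND.
Qed.

(** For [M] a power [s] of the next base, the coordinates above [k] keep at most [s] digits, while
    coordinate [k] keeps at least [g] more by [expn_gap]. Above the last coordinate there is
    nothing, and [p = 0] works. *)
Lemma level_gap k g : exists M p, [/\ (2 ^ g <= M)%N, (p + g <= level n M k)%N &
  forall l, (k < l)%N -> (M < n l ^ p.+1)%N].
Proof.
have pow2 l s : (g <= s)%N -> (2 ^ g <= n l ^ s)%N.
  move=> gs; case: g gs => [|g'] gs; first by rewrite expn_gt0 (ltnW (hn2 l)).
  by apply: (@leq_trans (n l ^ g'.+1)); rewrite ?leq_exp2r // leq_pexp2l // ltnW.
have [kd|dk] := ltnP k.+1 d; last first.
  exists (n k ^ g)%N, 0%N; split; first exact: pow2.
    by rewrite add0n /level trunc_expnK.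
  by move=> l kl; have := leq_trans dk kl; rewrite leqNgt ltn_ord.
pose k' := Ordinal kd; have kk : (n k < n k')%N by exact: hn.
pose s := (n k * n k * g)%N.
exists (n k' ^ s)%N, s; split.
- by apply: pow2; rewrite /s leq_pmull // muln_gt0 !(ltnW (hn2 k)).
- by apply: trunc_log_max => //; apply: expn_gap => //; exact: ltnW (hn2 k).
- move=> l kl; apply: (@leq_trans (n k' ^ s.+1)); first by rewrite ltn_exp2l // (hn2 k').
  by rewrite leq_exp2r // (leq_nk hn (k := k') kl).
Qed.

End NoIsland.

(** * The power law *)

Lemma powRN_inv (R : realType) (r g : R) : 0 <= r -> r `^ (- g) = r^-1 `^ g.
Proof. by move=> r0; rewrite -[r^-1]powR_inv1 // -powRrM mulN1r. Qed.

Section PowerLaw.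
Context (R : realType) (d : nat) (d2 : (2 <= d)%N).
Context (n : 'I_d -> nat) (hn2 : forall k, (2 <= n k)%N).
Hypothesis hn : forall k l : 'I_d, (k < l)%N -> (n k < n l)%N.
Context (D : {fset 'rV[nat]_d}) (D2 : (2 <= #|` D|)%N).
Hypothesis hD : forall i, i \in D -> forall k : 'I_d, (i ord0 k < n k)%N.
Context (E : set 'rV[R]_d) (hE : is_sponge n D E) (nd : ~ degenerated E).

Local Notation gamma := (sponge_dim R n D).
Local Notation dist := (@eucl_dist R d).
Let c1 : R := d%:R * (nmax n)%:R.

Let c1_gt0 : 0 < c1.
Proof.
rewrite mulr_gt0 ?ltr0n //; first exact: ltnW.
by apply: leq_trans (le_nmax n (Ordinal d2)); exact: ltnW (hn2 _).
Qed.

Let D_gt0 : 0 < #|` D|%:R :> R.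
Proof. by rewrite ltr0n; exact: ltnW. Qed.

Let gamma_gt0 : 0 < gamma := sponge_dim_gt0 R hn2 D2.

Lemma covered_by_sponge r : 0 < r < 1 -> exists2 m, Defs.covered_by dist E r m &
  m%:R <= (c1 + 1) `^ gamma * r `^ (- gamma).
Proof.
move=> /andP[r0 r1].
have cr0 : 0 <= c1 / r by rewrite divr_ge0 ?ltW.
have /andP[M1 M2] := truncn_itv cr0.
(* Cells at scale [1 / M] have diameter at most [c1 / M < r], and [M <= (c1 + 1) / r] because
   [r < 1]. *)
set M := (Num.Def.trunc (c1 / r)).+1 in M2.
exists (num_cells n D M).
  have [U [dU EU]] := @sponge_covered R d n hn2 D hD E hE M isT.
  exists U; split=> // i x y Ux Uy; apply: le_trans (dU _ _ _ Ux Uy) _.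
  rewrite mulrA -/c1 ler_pdivrMr ?ltr0n // mulrC.
  by rewrite -ler_pdivrMr // ltW.
apply: le_trans (num_cells_le R hn2 hn D2 (isT : (0 < M)%N)) _.
rewrite powRN_inv ?(ltW r0) // -powRM ?invr_ge0 ?(ltW r0) ?addr_ge0 ?(ltW c1_gt0) //.
apply: ge0_ler_powR; rewrite ?(ltW gamma_gt0) ?nnegrE //.
  by rewrite mulr_ge0 ?invr_ge0 ?addr_ge0 ?(ltW c1_gt0) ?(ltW r0).
rewrite mulrDl mul1r /M -natr1 lerD //.
by rewrite -[leLHS]invr1 lef_pV2 ?posrE // ltW.
Qed.

Lemma covering_number_sponge r : 0 < r < 1 ->
  covering_number dist E r <= (c1 + 1) `^ gamma * r `^ (- gamma).
Proof.
by move=> /covered_by_sponge[m Em]; apply: le_trans; exact: covering_number_le.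
Qed.

Lemma num_delta_components_covering_number r : 0 < r < 1 ->
  finite_set (delta_components dist E r) /\
  (num_delta_components dist E r)%:R <= covering_number dist E r.
Proof.
move=> /covered_by_sponge[m Em _].
have [fin _] := num_delta_components_le (@eucl_distC R d) Em; split=> //.
apply: covering_number_ge Em _ => m' Em'; rewrite ler_nat.
by have [] := num_delta_components_le (@eucl_distC R d) Em'.
Qed.

Lemma num_delta_components_islands : (forall k, exists U eta, island E (upto k) U eta) ->
  exists2 c : R, 0 < c & forall r, 0 < r < 1 ->
    c * r `^ (- gamma) <= (num_delta_components dist E r)%:R.
Proof.
move=> isl; have [U HU] := choice isl; have [eta Heta] := choice HU.
have [c0 c00 Hc0] := islands_separated hn2 hn hD hE Heta.
(* The half comes from rounding: the integer part of [c0 / r], if not 0, is at least half of it. The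
   divisor comes from [num_cells_ge]. *)
exists ((c0 / 2) `^ gamma / #|` D|%:R).
  by rewrite divr_gt0 // powR_gt0 // divr_gt0.
move=> r r01; have /andP[r0 r1] := r01.
have [fin _] := num_delta_components_covering_number r01.
have E1 : (c0 / 2) `^ gamma / #|` D|%:R * r `^ (- gamma) =
    (c0 / 2 / r) `^ gamma / #|` D|%:R.
  rewrite mulrAC; congr (_ / _).
  by rewrite powRN_inv ?(ltW r0) // -powRM ?invr_ge0 ?divr_ge0 ?(ltW c00) ?(ltW r0).
have cr0 : 0 <= c0 / r by rewrite divr_ge0 ?ltW.
rewrite {}E1 ler_pdivrMr //.
have [cr|cr] := leP 1 (c0 / r).
  have /andP[M1 M2] := truncn_itv cr0.
  have M0 : (0 < Num.Def.trunc (c0 / r))%N by rewrite truncn_gt0.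
  move: (Num.Def.trunc _) M0 M1 M2 => M M0 M1 M2.
  have [|p [Ep pinj]] := Hc0 M M0 r.
    by rewrite ler_pdivlMr ?ltr0n // mulrC -ler_pdivlMr.
  have numM := num_delta_components_ge fin Ep pinj.
  rewrite card_cell in numM.
  apply: (@le_trans _ _ (M%:R `^ gamma)).
    apply: ge0_ler_powR; rewrite ?(ltW gamma_gt0) ?nnegrE ?divr_ge0 ?(ltW c00) ?(ltW r0) //.
    have : 1 <= M%:R :> R by rewrite ler1n.
    move: M2; rewrite -natr1 mulrAC; lra.
  apply: le_trans (num_cells_ge R hn2 hn D2 M0) _.
  by rewrite mulrC; apply: ler_wpM2r; [exact: ltW|rewrite ler_nat].
(* For [r > c0] the claimed bound is at most 1, so one component suffices. *)
have [[x0 Ex0] _ _] := hE.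
have num1 : (1 <= num_delta_components dist E r)%N.
  apply: leq_trans (eq_leq (esym card_unit)) _.
  by apply: (num_delta_components_ge (p := fun=> x0)) => // -[] [].
apply: (@le_trans _ _ 1).
  have one : 1 `^ gamma = 1 :> R by rewrite powR1.
  rewrite -[leRHS]one; apply: ge0_ler_powR; rewrite ?(ltW gamma_gt0) ?nnegrE ?divr_ge0 ?(ltW c00) ?(ltW r0) //.
  by rewrite mulrAC; move: cr; lra.
rewrite -[leLHS]mulr1; apply: ler_pM => //; first by rewrite ler1n.
by rewrite ler1n ltnW.
Qed.

Lemma box_dim_of_bounds (cl cu : R) : 0 < cl -> 0 < cu ->
  (forall r, 0 < r < 1 ->
    cl * r `^ (- gamma) <= covering_number dist E r <= cu * r `^ (- gamma)) ->
  is_box_dim dist E gamma.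
Proof.
move=> cl0 cu0 H; pose K : R := `|ln cl| + `|ln cu|.
apply/cvgrPdist_le => e e0; near=> r.
have r0 : 0 < r by near: r; exact: nbhs_right_gt.
have r1 : r < 1 by near: r; exact: nbhs_right_lt.
(* The constants [cl] and [cu] perturb the quotient by at most [K / - ln r], which is below [e] from
   here on. *)
have rK : r < expR (- (K / e)) by near: r; apply: nbhs_right_lt; exact: expR_gt0.
have /H/andP[h1 h2] : 0 < r < 1 by rewrite r0.
have rg0 : 0 < r `^ (- gamma) by exact: powR_gt0.
have cov0 : 0 < covering_number dist E r by apply: lt_le_trans h1; rewrite mulr_gt0.
have lnr0 : 0 < - ln r by rewrite oppr_gt0 ln_lt0 // r0.
have lnK' : K / e < - ln r.
  by rewrite ltrNr -(expRK (- (K / e))) ltr_ln ?posrE ?expR_gt0.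
have lc : ln cl + gamma * - ln r <= ln (covering_number dist E r).
  by rewrite mulrN -mulNr -ln_powR -lnM ?posrE // ler_ln ?posrE ?mulr_gt0.
have uc : ln (covering_number dist E r) <= ln cu + gamma * - ln r.
  by rewrite mulrN -mulNr -ln_powR -lnM ?posrE // ler_ln ?posrE ?mulr_gt0.
rewrite -[X in X - _](mulfK (lt0r_neq0 lnr0)) -mulrBl normrM normfV (gtr0_norm lnr0).
rewrite ler_pdivrMr //; move: lnK'; rewrite ltr_pdivrMr // => /ltW lnK'.
apply: (@le_trans _ _ K); last by rewrite mulrC.
have := ler_norm (ln cu); have := ler_norm (- ln cl); rewrite normrN.
have := normr_ge0 (ln cu); have := normr_ge0 (ln cl).
by rewrite /K ler_norml => *; apply/andP; split; lra.
Unshelve. all: by end_near.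
Qed.

Lemma islands_power_law : (forall k, exists U eta, island E (upto k) U eta) ->
  maximal_power_law dist E.
Proof.
move=> /num_delta_components_islands[cl cl0 Hcl].
pose cu : R := (c1 + 1) `^ gamma.
have cu0 : 0 < cu by rewrite powR_gt0 // addr_gt0.
exists gamma => //; split; last first.
  apply: (box_dim_of_bounds cl0 cu0) => r r01.
  have [_ num] := num_delta_components_covering_number r01.
  by rewrite (le_trans (Hcl _ r01) num) covering_number_sponge.
have clV0 : 0 < cl^-1 by rewrite invr_gt0.
exists (1 + cl^-1 + cu); first by lra.
move=> r r01; have [_ num] := num_delta_components_covering_number r01.
have rg0 : 0 <= r `^ (- gamma) by exact: powR_ge0.
apply/andP; split.
  apply: le_trans (Hcl _ r01); rewrite ler_wpM2r // -[leRHS]invrK lef_pV2 ?posrE //; lra.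
apply: le_trans num (le_trans (covering_number_sponge r01) _).
rewrite -/cu ler_wpM2r //; lra.
Qed.

(** At the scales [1 / M], [num_cells_cover] and [num_cells_ge] bound the covering number below by
    [c2] times the power [gamma] of [M], too much for an exponent below [s < gamma]. *)
Lemma sponge_dim_le_box_dim gamma' : is_box_dim dist E gamma' -> gamma <= gamma'.
Proof.
move=> box; rewrite leNgt; apply/negP => lt.
pose c2 : R := (#|` D|%:R * (3 ^ d)%:R)^-1.
have c20 : 0 < c2 by rewrite invr_gt0 mulr_gt0 // ltr0n expn_gt0.
pose s := (gamma + gamma') / 2.
have s1 : gamma' < s by rewrite /s; lra.
have s2 : 0 < gamma - s by rewrite /s; lra.
have /(cvgr_lt _)/(_ _ s1) := box.
rewrite near_withinE => /nbhs_ballP[e /= e0 He].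
pose K : R := `|ln c2| / (gamma - s).
have Kpos : 0 < Num.min e (Num.min 1 (expR (- K))) by rewrite !lt_min e0 ltr01 expR_gt0.
have [N HN] := invr_nat_lt (e := Num.min e (Num.min 1 (expR (- K)))) Kpos.
have := HN N (leqnn N); set M := N.+1; rewrite !lt_min => /and3P[Me M1 MK].
have M0 : 0 < M%:R^-1 :> R by rewrite invr_gt0.
have M01 : 0 < (M%:R^-1 : R) < 1 by rewrite M0.
have := He M%:R^-1; rewrite -ball_normE /= sub0r normrN gtr0_norm // => /(_ Me M0).
have [m Em _] := covered_by_sponge M01.
have cov : c2 * M%:R `^ gamma <= covering_number dist E M%:R^-1.
  apply: covering_number_ge Em _ => m' Em'.
  have := num_cells_cover hn2 hD hE (isT : (0 < M)%N) Em'.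
  rewrite -(ler_nat R) natrM => h.
  rewrite /c2 mulrC ler_pdivrMr; last by rewrite mulr_gt0 // ltr0n expn_gt0.
  apply: le_trans (num_cells_ge R hn2 hn D2 (isT : (0 < M)%N)) _.
  by rewrite mulrCA; apply: ler_wpM2l; first exact: ltW.
have Mg0 : 0 < M%:R `^ gamma :> R by rewrite powR_gt0 ?ltr0n.
have cov0 : 0 < covering_number dist E M%:R^-1.
  by apply: lt_le_trans cov; rewrite mulr_gt0.
have lnM : K < ln M%:R.
  rewrite -ltrN2 -lnV ?posrE ?ltr0n // -(expRK (- K)) ltr_ln ?posrE ?expR_gt0 //.
have K0 : 0 <= K by rewrite divr_ge0 // ltW.
rewrite lnV ?posrE ?ltr0n // opprK ltr_pdivrMr ?(le_lt_trans K0) //.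
have : ln c2 + gamma * ln M%:R <= ln (covering_number dist E M%:R^-1).
  by rewrite -ln_powR -exp.lnM ?posrE // ler_ln ?posrE ?mulr_gt0.
move: lnM; rewrite /K ltr_pdivrMr // mulrBr.
have := ler_norm (- ln c2); rewrite normrN.
rewrite ![ln M%:R * _]mulrC; lra.
Qed.

Lemma power_law_islands : maximal_power_law dist E ->
  forall k, exists U eta, island E (upto k) U eta.
Proof.
move=> [gamma' _ [[c c_gt1 Hc] /sponge_dim_le_box_dim gg]] k; apply: contrapT => nI.
have c0 : 0 < c by apply: lt_trans c_gt1.
pose th : R := 1 - #|` D|%:R^-1.
have th01 : 0 <= th < 1.
  rewrite /th subr_ge0 invf_le1 // ler1n (ltnW D2) /= gtrDl oppr_lt0 invr_gt0 //.
(* The value of [th ^+ g] at which the upper bound of [components_no_island] would meet the lower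
   bound of the power law at step [c1 / M]. *)
pose eps : R := c^-1 * (c1 `^ gamma)^-1 / (d * 2)%:R.
have dd : 0 < (d * 2)%:R :> R by rewrite ltr0n muln_gt0 (ltnW d2).
have eps0 : 0 < eps by rewrite !divr_gt0 ?invr_gt0 // powR_gt0.
have [N HN] : exists N, forall g, (N <= g)%N -> th ^+ g < eps.
  have /(cvgr_lt _)/(_ _ eps0) : th ^+ g @[g --> \oo] --> 0.
    by apply: cvg_expr; rewrite ger0_norm; case/andP: th01.
  by move=> [N _ HN]; exists N.
(* This forces [M > c1]: the step [c1 / M] is then below 1, and the exponent [gamma'] of [M / c1]
   may be lowered to [gamma]. *)
have [q Hq] : exists q, (2 ^+ q)^-1 < c1^-1 by apply: expVn2_lt; rewrite invr_gt0.
pose g := maxn N q.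
have [M [p [Mg pg Hp]]] := level_gap hn2 hn k g.
have Mc1 : c1 < M%:R.
  move: Hq; rewrite ltf_pV2 ?posrE ?exprn_gt0 // => Hq; apply: lt_le_trans Hq _.
  rewrite -natrX ler_nat; apply: leq_trans Mg; by rewrite leq_exp2l // leq_maxr.
have M0 : (0 < M)%N by rewrite -(ltr0n R); exact: lt_trans Mc1.
have M0R : 0 < M%:R :> R by rewrite ltr0n.
have dl01 : 0 < c1 / M%:R < 1 by rewrite divr_gt0 //= ltr_pdivrMr // mul1r.
have /andP[lo _] := Hc _ dl01.
have pk : (p <= level n M k)%N by apply: leq_trans pg; exact: leq_addr.
have := components_no_island hn2 hn D2 hD hE nd nI M0 pk Hp.
rewrite mulrA -/c1 => up; have {lo up} := le_trans lo up.
have pw : M%:R `^ gamma / c1 `^ gamma <= (c1 / M%:R) `^ (- gamma').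
  have -> : (c1 / M%:R) `^ (- gamma') = (M%:R / c1) `^ gamma'.
    by rewrite powRN_inv ?invf_div // divr_ge0 // ltW.
  apply: (@le_trans _ _ ((M%:R / c1) `^ gamma)).
    have c1V0 : 0 <= c1^-1 by rewrite invr_ge0 ltW.
    by rewrite (powRM gamma (ltW M0R) c1V0) -(powRN_inv gamma (ltW c1_gt0)) powRN.
  by apply: ler_powR => //; rewrite ler_pdivlMr // mul1r ltW.
have thg : th ^+ (level n M k - p) <= th ^+ g.
  case/andP: th01 => t0 t1; apply: ler_wiXn2l => //; first exact: ltW.
  by rewrite leq_subRL.
have := num_cells_le R hn2 hn D2 M0; move=> cells.
apply/negP; rewrite -ltNge.
apply: (@lt_le_trans _ _ (c^-1 * (M%:R `^ gamma / c1 `^ gamma))); last first.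
  by rewrite ler_wpM2l // invr_ge0 ltW.
apply: (@le_lt_trans _ _ ((d * 2)%:R * (th ^+ g * M%:R `^ gamma))).
  rewrite ler_wpM2l //; apply: ler_pM => //; rewrite exprn_ge0 //; by case/andP: th01.
have := HN g (leq_maxl _ _); rewrite /eps ltr_pdivlMr // => h.
have -> : c^-1 * (M%:R `^ gamma / c1 `^ gamma) = c^-1 * (c1 `^ gamma)^-1 * M%:R `^ gamma.
  by rewrite -mulrA [_^-1 * M%:R `^ _]mulrC.
by rewrite mulrA ltr_pM2r ?powR_gt0 // mulrC.
Qed.

End PowerLaw.

Theorem theorem1p2 (R : realType) (d : nat) (hd : (2 <= d)%N)
    (n : 'I_d -> nat) (hn2 : forall k, (2 <= n k)%N)
    (hn : forall k l : 'I_d, (k < l)%N -> (n k < n l)%N)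
    (D : {fset 'rV[nat]_d}) (hN : (2 <= #|` D|)%N)
    (hD : forall i, i \in D -> forall k : 'I_d, (i ord0 k < n k)%N)
    (E : set 'rV[R]_d) (hE : is_sponge n D E) (hnd : ~ degenerated E) :
  maximal_power_law (@eucl_dist R d) E <->
  ((exists z, trivial_point E z) /\
   (forall j : 'I_d, (1 <= j)%N -> exists z, trivial_point (proj_first j @` E) z)).
Proof.
rewrite (trivial_points_islands hn2 hD hE hnd hd); split.
  exact: (power_law_islands hd hn2 hn hN hD hE hnd).
exact: (islands_power_law hd hn2 hn hN hD hE).
Qed.
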